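(* Let $\kappa$ be a cardinal with $\kappa>2^{\mathrm{cf}(\kappa)}>\mathrm{cf}(\kappa)>\omega$ and $2^\kappa=\kappa^+$. Then $\mathrm{ro}(\mathrm{sq}(\mathbb P(\omega^\kappa)))\cong\mathrm{Col}(\omega,2^\kappa)$.
   Context: Ordinal exponentiation: $\omega^\kappa=\kappa$ for such $\kappa$. $\mathbb P(\omega^\kappa)$ is the poset of subsets of $\omega^\kappa$ order-isomorphic to $\omega^\kappa$, ordered by $\subset$; $\mathrm{sq}$ is separative quotient; $\mathrm{ro}$ is Boolean completion; $\mathrm{Col}(\omega,\mu)$ is the Boolean completion of $\langle{}^{<\omega}\mu,\supset\rangle$. *)

(* Defs.v *)
From Stdlib Require Import List.
Import ListNotations.

Definition inj_le (A B : Type) : Prop :=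
  exists f : A -> B, forall x y, f x = f y -> x = y.
Definition card_lt (A B : Type) : Prop := inj_le A B /\ ~ inj_le B A.

Definition strict_well_order {T : Type} (lt : T -> T -> Prop) : Prop :=
  (forall x, ~ lt x x) /\
  (forall x y z, lt x y -> lt y z -> lt x z) /\
  (forall x y, lt x y \/ x = y \/ lt y x) /\
  well_founded lt.

Definition is_cardinal {K : Type} (lt : K -> K -> Prop) : Prop :=
  strict_well_order lt /\ forall x : K, ~ inj_le K {y : K | lt y x}.

Definition cofinal {K : Type} (lt : K -> K -> Prop) (A : K -> Prop) : Prop :=
  forall x, exists y, A y /\ ~ lt y x.
Definition is_cofinality {K : Type} (lt : K -> K -> Prop) (C : Type) : Prop :=
  (exists A : K -> Prop, cofinal lt A /\ inj_le C {y | A y} /\ inj_le {y | A y} C) /\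
  (forall A : K -> Prop, cofinal lt A -> inj_le C {y | A y}).

Definition powerset_is_successor (K : Type) : Prop :=
  card_lt K (K -> Prop) /\
  forall S : (K -> Prop) -> Prop,
    inj_le {X | S X} K \/ inj_le (K -> Prop) {X | S X}.

(** * Posets, separative quotient, regular open (Boolean) completion.
    Convention: [le p q] means p is stronger than (below) q. *)
Definition compat {T : Type} (le : T -> T -> Prop) (p q : T) : Prop :=
  exists r, le r p /\ le r q.

Definition regular_open {T : Type} (le : T -> T -> Prop) (U : T -> Prop) : Prop :=
  (forall p q, U p -> le q p -> U q) /\
  (forall p, (forall q, le q p -> exists r, le r q /\ U r) -> U p).

Definition ro (T : Type) (le : T -> T -> Prop) : Type :=
  {U : T -> Prop | regular_open le U}.
Definition ro_le {T : Type} {le : T -> T -> Prop} (U V : ro T le) : Prop :=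
  forall p, proj1_sig U p -> proj1_sig V p.

Definition ro_iso (T1 : Type) (le1 : T1 -> T1 -> Prop)
                  (T2 : Type) (le2 : T2 -> T2 -> Prop) : Prop :=
  exists f : ro T1 le1 -> ro T2 le2,
    (forall U V, f U = f V -> U = V) /\
    (forall W, exists U, f U = W) /\
    (forall U V, ro_le U V <-> ro_le (f U) (f V)).

Definition sep_le {T : Type} (le : T -> T -> Prop) (p q : T) : Prop :=
  forall r, le r p -> compat le r q.
Definition sep_class {T : Type} (le : T -> T -> Prop) (p : T) : T -> Prop :=
  fun x => sep_le le x p /\ sep_le le p x.
Definition sq (T : Type) (le : T -> T -> Prop) : Type :=
  {c : T -> Prop | exists p, c = sep_class le p}.
Definition sq_le {T : Type} (le : T -> T -> Prop) (c d : sq T le) : Prop :=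
  exists p q, proj1_sig c = sep_class le p /\ proj1_sig d = sep_class le q /\
              sep_le le p q.

(** * The poset P(omega^kappa) (with omega^kappa = kappa, identified with K):
    subsets of K order-isomorphic to (K, lt), ordered by inclusion. *)
Definition order_iso_to_K {K : Type} (lt : K -> K -> Prop) (X : K -> Prop) : Prop :=
  exists f : K -> K,
    (forall x, X (f x)) /\
    (forall y, X y -> exists x, f x = y) /\
    (forall a b, lt a b <-> lt (f a) (f b)).
Definition PK {K : Type} (lt : K -> K -> Prop) : Type :=
  {X : K -> Prop | order_iso_to_K lt X}.
Definition PK_le {K : Type} (lt : K -> K -> Prop) (X Y : PK lt) : Prop :=
  forall x, proj1_sig X x -> proj1_sig Y x.

(** * Col(omega, M): finite sequences in M ordered by reverse extension
    ([s] below [t] iff [s] extends [t]); its Boolean completion is ro. *)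
Definition col_le (M : Type) (s t : list M) : Prop := exists u, s = t ++ u.

(* Main.v *)
From Stdlib Require Import ssreflect List Arith Lia Cantor Wellfounded ClassicalEpsilon.
From Stdlib Require Import FunctionalExtensionality PropExtensionality.
From mathcomp Require ssrbool eqtype boolp wochoice.
Require Import Defs.

(** [P(omega^kappa)] is the set of subsets of [kappa] of size [kappa] (the "big"
    sets), and two of them are compatible iff their intersection is big; the small
    sets form a [cf(kappa)]-complete ideal. The point is to find names [t n], for
    [n < omega], of elements of [2^kappa] such that every big [X] leaves all values
    of some [t n] possible: deciding them level by level gives a dense copy of the
    tree of finite sequences in [2^kappa].

    Write [id] for the identity map of [kappa] and fix a greedily chosen sequence of
    clubs of [kappa], decreasing modulo bounded sets, such that every big set can be
    shrunk to one avoiding a club of the sequence. The label of a big set is the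
    first club it almost avoids; composing with the map [x |-> sup (D /\ x)], which
    is regressive off the club [D], replaces [id] by a smaller function, and the
    process can be repeated. If fewer than [cf(kappa)] labels were possible at every
    step below [X], then, as [cf(kappa) > omega], almost every point of [X] would
    yield an infinite descending sequence. So at some step [cf(kappa)] labels are
    possible; they converge to a further label [d], and give a partition of the
    complement of the club of [d] into [cf(kappa)] pieces, unboundedly many of which
    meet [X] in a big set. Since [2^kappa = kappa^+], a recursion of length [kappa^+]
    gives an almost disjoint family of sets with at most [|k|] points in the [k]-th
    piece, and with every value attached to a member below each such [X]. *)

Local Notation seg lt k := {y | lt y k}.
Local Notation set_type X := {x | X x}.

(** * Cardinal arithmetic *)

Section Injections.

Lemma proj1_sig_inj {T : Type} {P : T -> Prop} (u v : {x | P x}) :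
  proj1_sig u = proj1_sig v -> u = v.
Proof. exact: eq_sig_hprop (fun x p q => proof_irrelevance _ p q) u v. Qed.

Lemma inj_le_rel {A B : Type} (R : A -> B -> Prop) :
  (forall a, exists b, R a b) ->
  (forall a a' b, R a b -> R a' b -> a = a') -> inj_le A B.
Proof.
move=> tot inj.
pose f a := proj1_sig (constructive_indefinite_description _ (tot a)).
have fP a : R a (f a) by exact: proj2_sig (constructive_indefinite_description _ (tot a)).
exists f => x y e; apply: (inj x y (f x)) => //; rewrite e; exact: fP.
Qed.

Lemma inj_le_relS {T B : Type} {X : T -> Prop} (R : T -> B -> Prop) :
  (forall a, X a -> exists b, R a b) ->
  (forall a a' b, X a -> X a' -> R a b -> R a' b -> a = a') ->
  inj_le (set_type X) B.
Proof.
move=> tot inj; apply: (inj_le_rel (fun a b => R (proj1_sig a) b)).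
- by case=> a Xa; exact: tot.
- by case=> a Xa [a' Xa'] b /= r r'; apply: proj1_sig_inj; exact: inj r r'.
Qed.

Lemma inj_le_refl (A : Type) : inj_le A A.
Proof. by exists (fun x => x). Qed.

Lemma inj_le_trans {A B D : Type} : inj_le A B -> inj_le B D -> inj_le A D.
Proof. by case=> f fi [g gi]; exists (fun x => g (f x)) => x y /gi /fi. Qed.

Lemma inj_le_sub {T : Type} {X Y : T -> Prop} :
  (forall x, X x -> Y x) -> inj_le (set_type X) (set_type Y).
Proof.
move=> s; exists (fun u => exist Y (proj1_sig u) (s _ (proj2_sig u))) => u v [].
exact: proj1_sig_inj.
Qed.

Lemma inj_le_set {T : Type} (X : T -> Prop) : inj_le (set_type X) T.
Proof. exists (@proj1_sig _ _); exact: proj1_sig_inj. Qed.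

Lemma inj_le_prod {A A' B B' : Type} :
  inj_le A A' -> inj_le B B' -> inj_le (A * B) (A' * B').
Proof.
by case=> f fi [g gi]; exists (fun p => (f (fst p), g (snd p))) => -[a b] [c d] /= []
  /fi -> /gi ->.
Qed.

Lemma inj_le_sum {A A' B B' : Type} :
  inj_le A A' -> inj_le B B' -> inj_le (A + B) (A' + B').
Proof.
case=> f fi [g gi].
exists (fun u => match u with inl a => inl (f a) | inr b => inr (g b) end).
by case=> a [] b //= [] => [/fi|/gi] ->.
Qed.

Lemma inj_le_nat_prod : inj_le (nat * nat) nat.
Proof. exists Cantor.to_nat; exact: Cantor.to_nat_inj. Qed.

Lemma inj_le_nat_sum : inj_le (nat + nat) nat.
Proof.
exists (fun u => match u with inl n => 2 * n | inr n => 2 * n + 1 end).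
by case=> a [] b e; f_equal; lia.
Qed.

Lemma inj_le_sum_nat {A : Type} : inj_le nat A -> inj_le (A + nat) A.
Proof.
case=> f fi.
apply: (inj_le_rel (fun u a => match u with
  | inl b => (exists n, b = f n /\ a = f (2 * n)) \/ (~ (exists n, b = f n) /\ a = b)
  | inr n => a = f (2 * n + 1) end)).
- case=> [b|n]; last by eexists.
  case: (classic (exists n, b = f n)) => [[n e]|N]; last by exists b; right.
  by exists (f (2 * n)); left; exists n.
- case=> [b|n] [b'|n'] a.
  + case=> [[n [-> ->]]|[N ->]] [[n' [-> e]]|[N' e]].
    * by do 2 f_equal; move/fi: e; lia.
    * by case: N'; exists (2 * n); rewrite -e.
    * by case: N; exists (2 * n').
    * by rewrite e.
  + by case=> [[n [-> ->]] /fi|[N ->] e]; [lia|case: N; eexists; exact: e].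
  + by move=> -> [[m [-> /fi]]|[N e]]; [lia|case: N; eexists; symmetry; exact: e].
  + by move=> -> /fi e; f_equal; lia.
Qed.

End Injections.

(** * Well-orders and recursion along them *)

Section WellOrders.
Context {T : Type} {lt : T -> T -> Prop} (wo : strict_well_order lt).

Lemma wo_irr x : ~ lt x x. Proof. by case: wo. Qed.
Lemma wo_trans y x z : lt x y -> lt y z -> lt x z.
Proof. case: wo => _ [tr _]; exact: tr. Qed.
Lemma wo_tri x y : lt x y \/ x = y \/ lt y x.
Proof. by case: wo => _ [_ [t _]]. Qed.
Lemma wo_wf : well_founded lt. Proof. by case: wo => _ [_ [_ w]]. Qed.
Lemma wo_asym x y : lt x y -> ~ lt y x.
Proof. by move=> a b; apply: (wo_irr x); exact: wo_trans a b. Qed.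
Lemma nlt_cases x y : ~ lt y x -> lt x y \/ x = y.
Proof. by case: (wo_tri x y) => [|[]]; auto. Qed.
Lemma nlt_lt_trans y x z : ~ lt y x -> lt y z -> lt x z.
Proof. by move=> /nlt_cases [a b|-> //]; exact: wo_trans a b. Qed.
Lemma lt_nlt_trans y x z : lt x y -> ~ lt z y -> lt x z.
Proof. by move=> a /nlt_cases [b|<- //]; exact: wo_trans a b. Qed.
Lemma nlt_trans y x z : ~ lt y x -> ~ lt z y -> ~ lt z x.
Proof. by move=> a b c; apply: b; exact: lt_nlt_trans c a. Qed.

Lemma wo_min (P : T -> Prop) :
  (exists x, P x) -> exists x, P x /\ forall y, lt y x -> ~ P y.
Proof.
case=> x; elim: (wo_wf x) => {}x _ IH Px.
case: (classic (exists y, lt y x /\ P y)) => [[y [yx Py]]|N]; first exact: IH yx Py.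
by exists x; split=> // y yx Py; apply: N; exists y.
Qed.

Lemma wo_max x y : exists z, ~ lt z x /\ ~ lt z y /\ (z = x \/ z = y).
Proof.
case: (wo_tri x y) => [xy|[->|yx]].
- by exists y; split; [exact: wo_asym|split; [exact: wo_irr|right]].
- by exists y; split; [exact: wo_irr|split; [exact: wo_irr|right]].
- by exists x; split; [exact: wo_irr|split; [exact: wo_asym|left]].
Qed.

Lemma wf_recursion {A : Type} (F : forall k, (forall j, lt j k -> A) -> A) :
  exists g : T -> A, forall k, g k = F k (fun j _ => g j).
Proof.
exists (Fix wo_wf (fun _ => A) F) => k; apply: Fix_eq => x f g e.
by congr F; do 2 apply: functional_extensionality_dep => ?; exact: e.
Qed.

(** Elements of [A] are enumerated along [T] without repetition: either this never stops and embeds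
    [T] in [A], or at some stage [k] the earlier values exhaust [A]. *)
Lemma inj_le_or_seg (A : Type) : inj_le T A \/ exists k, inj_le A (seg lt k).
Proof.
case: (classic (inhabited A)) => [iA|N]; last first.
  case: (classic (inhabited T)) => [[k]|N']; [right; exists k|left].
    by apply: (inj_le_rel (fun _ _ => True)) => a; case: N.
  by apply: (inj_le_rel (fun _ _ => True)) => a; case: N'.
have [g gE] := wf_recursion (fun k r => epsilon iA (fun a => forall j h, r j h <> a)).
case: (classic (forall k, exists a, forall j, lt j k -> g j <> a)) => [H|/not_all_ex_not [k N]].
- left; exists g => x y e.
  have gP k : forall j, lt j k -> g j <> g k.
    by move=> j jk; rewrite [g k]gE; apply: (epsilon_spec iA (fun a => forall j, lt j k -> g j <> a)).
  by case: (wo_tri x y) => [xy|[//|yx]]; [case: (gP _ _ xy)|case: (gP _ _ yx)].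
- right; exists k; apply: (inj_le_rel (fun a u => g (proj1_sig u) = a)) => [a|a a' u <- <- //].
  apply: NNPP => N'; apply: N; exists a => j jk e; apply: N'.
  by exists (exist _ j jk).
Qed.

Lemma seg_mono x y : ~ lt y x -> inj_le (seg lt x) (seg lt y).
Proof. by move=> xy; apply: inj_le_sub => z zx; exact: lt_nlt_trans zx xy. Qed.

Lemma wo_pullback {U : Type} (f : U -> T) : (forall u v, f u = f v -> u = v) ->
  strict_well_order (fun u v => lt (f u) (f v)).
Proof.
move=> fi; split; first by move=> x; exact: wo_irr.
split; first by move=> x y z; exact: wo_trans.
split; last exact: wf_inverse_image wo_wf.
by move=> x y; case: (wo_tri (f x) (f y)) => [|[/fi|]]; auto.
Qed.

End WellOrders.

(** * The well-ordering theorem and initial well-orders *)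

Section Zermelo.
Import ssrbool eqtype boolp.

(** The order [R] is known only through least elements of nonempty sets; sets of two or three points
    yield the order axioms, and the strict order is the negation of the reverse of [R]. *)
Theorem zermelo (T : Type) : exists lt : T -> T -> Prop, strict_well_order lt.
Proof.
have [R wR] := wochoice.well_ordering_principle (classicType T).
have min (P : T -> Prop) : (exists x, P x) -> exists z, P z /\ forall x, P x -> R z x.
  case=> x Px.
  have [|z [[Az lb] _]] := wR (fun y => asbool (P y)).
    by exists x; apply/asboolP.
  exists z; split; first by apply/asboolP; exact: Az.
  by move=> y Py; apply: lb; apply/asboolP.
have tot x y : R x y \/ R y x.
  have [|z [[]->]] := min (fun u => u = x \/ u = y); first by exists x; left.
    by move=> H; left; apply: H; right.
  by move=> H; right; apply: H; left.
have anti x y : R x y -> R y x -> x = y.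
  move=> xy yx; have [|z [_ U]] := wR (fun u => asbool (u = x \/ u = y)).
    by exists x; apply/asboolP; left.
  have [rx ry] : R x x /\ R y y by case: (tot x x); case: (tot y y).
  rewrite -(U x) ?(U y) //; split; try by apply/asboolP; auto.
  - by move=> u /asboolP [] ->.
  - by move=> u /asboolP [] ->.
have trans y x z : R x y -> R y z -> R x z.
  move=> xy yz; have [|m [[->|[->|->]] H]] := min (fun u => u = x \/ u = y \/ u = z).
  - by exists x; left.
  - by apply: H; auto.
  - by have <- : y = x by apply: anti xy; apply: H; auto.
  - have e : z = y by apply: anti yz; apply: H; auto.
    by rewrite e.
exists (fun x y => ~ R y x); split; [|split; [|split]].
- by move=> x; case: (tot x x) => H; apply.
- move=> x y z nyx nzy zx; apply: nzy.
  by apply: (trans x) => //; case: (tot x y).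
- move=> x y; case: (Classical_Prop.classic (R y x)) => [yx|]; last by left.
  case: (Classical_Prop.classic (R x y)) => [xy|]; last by right; right.
  by right; left; exact: anti.
- move=> x; apply: Classical_Prop.NNPP => N.
  have [|z [Nz H]] := min (fun u => ~ Acc (fun x y => ~ R y x) u); first by exists x.
  apply: Nz; constructor => y nzy; apply: Classical_Prop.NNPP => Ny; apply: nzy; exact: H.
Qed.

End Zermelo.

Theorem initial_order (T : Type) : exists lt : T -> T -> Prop, is_cardinal lt.
Proof.
have [lt wo] := zermelo T.
case: (classic (exists m, inj_le T (seg lt m))) => [E|N]; last first.
  by exists lt; split=> // x H; apply: N; exists x.
have [m [[g gi] min]] := wo_min wo _ E.
exists (fun u v => lt (proj1_sig (g u)) (proj1_sig (g v))); split.
- by apply: (wo_pullback wo (fun u => proj1_sig (g u))) => u v /proj1_sig_inj /gi.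
- move=> x H; apply: (min (proj1_sig (g x)) (proj2_sig (g x))).
  apply: inj_le_trans H _; apply: (inj_le_relS (fun u v => proj1_sig (g u) = proj1_sig v)).
  + by move=> a lax; exists (exist _ (proj1_sig (g a)) lax).
  + by move=> a a' b _ _ <- /proj1_sig_inj /gi.
Qed.

Lemma inj_le_total (A B : Type) : inj_le A B \/ inj_le B A.
Proof.
have [lt wo] := zermelo A.
case: (inj_le_or_seg wo B) => [|[k H]]; first by left.
by right; apply: inj_le_trans H _; exact: inj_le_set.
Qed.

Lemma inj_le_of_not {A B : Type} : ~ inj_le A B -> inj_le B A.
Proof. by case: (inj_le_total A B). Qed.

(** * Squares of infinite cardinals, by Gödel's ordering of pairs *)

Section MaxLex.
Context {U : Type} {lt : U -> U -> Prop} (wo : strict_well_order lt).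

Definition max_of (a b : U) : U :=
  match excluded_middle_informative (lt a b) with left _ => b | right _ => a end.

Definition max_lex (p q : U * U) : Prop :=
  lt (max_of (fst p) (snd p)) (max_of (fst q) (snd q)) \/
  max_of (fst p) (snd p) = max_of (fst q) (snd q) /\
  (lt (fst p) (fst q) \/ fst p = fst q /\ lt (snd p) (snd q)).

Lemma nlt_max_of a b : ~ lt (max_of a b) a /\ ~ lt (max_of a b) b.
Proof.
rewrite /max_of; case: excluded_middle_informative => [ab|nab].
- by split; [exact: wo_asym|exact: wo_irr].
- by split; [exact: wo_irr|].
Qed.

Lemma max_lex_wo : strict_well_order max_lex.
Proof.
split; [|split; [|split]].
- by case=> a b [|[_ [|[_]]]] /(wo_irr wo).
- case=> a b [c d] [e f]; rewrite /max_lex /=.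
  case=> [H|[-> H]] [H'|[<- H']].
  + by left; exact: (wo_trans wo _ _ _ H H').
  + by left.
  + by left.
  + right; split=> //; case: H H' => [H|[-> H]] [H'|[<- H']]; auto.
    * by left; exact: (wo_trans wo _ _ _ H H').
    * by right; split=> //; exact: (wo_trans wo _ _ _ H H').
- case=> a b [c d]; rewrite /max_lex /=.
  case: (wo_tri wo (max_of a b) (max_of c d)) => [|[->|]]; try tauto.
  case: (wo_tri wo a c) => [|[->|]]; try tauto.
  by case: (wo_tri wo b d) => [|[->|]]; tauto.
- have H : forall m a b, max_of a b = m -> Acc max_lex (a, b).
    move=> m; elim: (wo_wf wo m) => {}m _ IHm a.
    elim: (wo_wf wo a) => {}a _ IHa b.
    elim: (wo_wf wo b) => {}b _ IHb e.
    constructor => -[c d]; rewrite /max_lex /=; rewrite e.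
    case=> [h|[e' [h|[ec h]]]]; first by exact: IHm h _ _ eq_refl.
    + exact: IHa h _ e'.
    + rewrite ec; apply: IHb h _; by rewrite -ec.
  by case=> a b; exact: H eq_refl.
Qed.

(* An initial segment of [max_lex] lies in the square of a closed segment of [lt]. *)
Lemma inj_le_square_step :
  (forall u, ~ inj_le U (seg lt u)) -> inj_le nat U ->
  (forall u, inj_le nat (seg lt u) -> inj_le (seg lt u * seg lt u) (seg lt u)) ->
  inj_le (U * U) U.
Proof.
move=> card inf IH.
case: (inj_le_or_seg max_lex_wo U) => [//|[[a b] H]].
set m := max_of a b.
have {}H : inj_le U ((seg lt m + nat) * (seg lt m + nat)).
  apply: inj_le_trans H _.
  pose R x (y : seg lt m + nat) := (exists h, y = inl (exist _ x h)) \/ (x = m /\ y = inr 0).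
  have Rtot x : ~ lt m x -> exists y, R x y.
    move=> /(nlt_cases wo) [h|->]; last by exists (inr 0); right.
    by exists (inl (exist _ x h)); left; exists h.
  have Rinj x x' y : R x y -> R x' y -> x = x'.
    by case=> [[h ->]|[-> ->]] [[h' //]|[-> //]] => -[].
  apply: (inj_le_relS (fun p q => R (fst p) (fst q) /\ R (snd p) (snd q))).
  - case=> c d /= cd.
    have cdm : ~ lt m (max_of c d).
      by case: cd => [|[-> _]]; [exact: wo_asym|exact: wo_irr].
    have [x Rx] := Rtot c (nlt_trans wo _ _ _ (proj1 (nlt_max_of c d)) cdm).
    have [y Ry] := Rtot d (nlt_trans wo _ _ _ (proj2 (nlt_max_of c d)) cdm).
    by exists (x, y).
  - case=> c d [c' d'] [x y] _ _ /= [Rx Ry] [Rx' Ry'].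
    by rewrite (Rinj _ _ _ Rx Rx') (Rinj _ _ _ Ry Ry').
case: (classic (inj_le nat (seg lt m))) => [i|ni].
- case: (card m); apply: inj_le_trans H _.
  have E := inj_le_sum_nat i.
  apply: inj_le_trans (inj_le_prod E E) _; exact: IH.
- have /inj_le_sum E := inj_le_of_not ni.
  have {}E := inj_le_trans (E _ _ (inj_le_refl nat)) inj_le_nat_sum.
  have {}H := inj_le_trans H (inj_le_trans (inj_le_prod E E) inj_le_nat_prod).
  apply: inj_le_trans inf; apply: inj_le_trans inj_le_nat_prod.
  exact: inj_le_prod.
Qed.

End MaxLex.

(** The induction is on a bound [x] for the size of [A], for all types [A] at once: each [A] gets an
    initial order, whose segments are then compared with segments below [x]. *)
Theorem inj_le_square (T : Type) : inj_le nat T -> inj_le (T * T) T.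
Proof.
have [lt [wo card]] := initial_order T.
have H : forall (x : T) (A : Type),
    inj_le A (seg lt x) -> inj_le nat A -> inj_le (A * A) A.
  move=> x; elim: (wo_wf wo x) => {}x _ IH A Ax infA.
  have [ltA [woA cardA]] := initial_order A.
  apply: (inj_le_square_step woA cardA infA) => u infu.
  have wox := wo_pullback wo (@proj1_sig T (fun y => lt y x)) (@proj1_sig_inj _ _).
  case: (inj_le_or_seg wox (seg ltA u)) => [H|[[y yx] H]].
    case: (cardA u); exact: inj_le_trans Ax H.
  apply: (IH y yx) => //; apply: inj_le_trans H _.
  apply: (inj_le_relS (fun v w => proj1_sig v = proj1_sig w)) => [v vy|v v' w _ _ <-].
  - by exists (exist _ (proj1_sig v) vy).
  - by move/proj1_sig_inj.
move=> inf; apply: (inj_le_square_step wo card inf) => u infu.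
exact: H (inj_le_refl _) infu.
Qed.

(** * The ideal of sets of size less than kappa *)

Section Small.
Context {K : Type} {lt : K -> K -> Prop} (hK : is_cardinal lt).
Context (uncK : ~ inj_le K nat).

Definition small (A : Type) : Prop := ~ inj_le K A.
Definition big (X : K -> Prop) : Prop := inj_le K (set_type X).

Let wo : strict_well_order lt := proj1 hK.

Lemma small_le {A B : Type} : inj_le A B -> small B -> small A.
Proof. by move=> AB sB KA; apply: sB; exact: inj_le_trans KA AB. Qed.

Lemma small_seg (k : K) : small (seg lt k).
Proof. case: hK => _; exact. Qed.

Lemma small_bounded {A : Type} : small A -> exists k, inj_le A (seg lt k).
Proof. by case: (inj_le_or_seg wo A). Qed.

Lemma small_prod {A B : Type} : small A -> small B -> small (A * B).
Proof.
move=> /small_bounded [a Aa] /small_bounded [b Bb].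
have [m [am [bm _]]] := wo_max wo a b.
have {}Aa := inj_le_trans Aa (seg_mono wo _ _ am).
have {}Bb := inj_le_trans Bb (seg_mono wo _ _ bm).
apply: small_le (inj_le_prod Aa Bb) _.
case: (classic (inj_le nat (seg lt m))) => [i|ni].
- apply: small_le (inj_le_square _ i) _; exact: small_seg.
- have E := inj_le_of_not ni.
  apply: small_le (inj_le_prod E E) _; exact: small_le inj_le_nat_prod _.
Qed.

Lemma small_nat : small nat. Proof. exact: uncK. Qed.

(** Adjoining [nat] keeps a set small and supplies the filler [0] with which the sum embeds in a
    product. *)
Lemma small_sum {A B : Type} : small A -> small B -> small (A + B).
Proof.
move=> sA sB.
have infK := inj_le_of_not uncK.
have sAB : small ((A + nat) * (B + nat)).
  have H D : small D -> small (D + nat).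
    case: (classic (inj_le nat D)) => [i|/inj_le_of_not i] sD.
    - exact: small_le (inj_le_sum_nat i) _.
    - apply: small_le (inj_le_sum i (inj_le_refl _)) _.
      exact: small_le inj_le_nat_sum _.
  exact: small_prod (H _ sA) (H _ sB).
apply: small_le sAB.
exists (fun u => match u with inl a => (inl a, inr 0) | inr b => (inr 0, inl b) end).
by case=> a [] b //= [] ->.
Qed.

Lemma small_closed_seg (k : K) : small {y | ~ lt k y}.
Proof.
apply: (@small_le _ (seg lt k + nat)); last exact: small_sum (small_seg k) small_nat.
apply: (inj_le_relS (fun y u => (exists h, u = inl (exist _ y h)) \/ (y = k /\ u = inr 0))).
- move=> y /(nlt_cases wo) [h|->]; last by exists (inr 0); right.
  by exists (inl (exist _ y h)); left; exists h.
- by move=> y y' u _ _ [[h ->]|[-> ->]] [[h' //]|[-> //]] => -[].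
Qed.

(** One bound [B] serves all pieces, since kappa may be singular: small pieces of unbounded sizes
    could have a big union. *)
Lemma small_union_le {T U B : Type} {P : T -> Prop} (S : T -> U -> Prop) :
  small (set_type P) -> small B ->
  (forall t, P t -> inj_le (set_type (S t)) B) ->
  small {x | exists t, P t /\ S t x}.
Proof.
move=> sP sB H; apply: small_le (small_prod sP sB).
have {}H t : exists R : U -> B -> Prop, P t -> (forall x, S t x -> exists b, R x b) /\
    forall x x' b, R x b -> R x' b -> x = x'.
  case: (classic (P t)) => Pt; last by exists (fun _ _ => True).
  have [g gi] := H t Pt; exists (fun x b => exists h, g (exist _ x h) = b) => _; split.
  - by move=> x h; exists (g (exist _ x h)), h.
  - by move=> x x' b [h <-] [h' /gi []].
have [R RP] := choice _ H.
apply: (inj_le_relS (fun x u => R (proj1_sig (fst u)) x (snd u))).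
- move=> x [t [Pt /(proj1 (RP t Pt)) [b Rb]]]; by exists (exist _ t Pt, b).
- by move=> x x' [[t Pt] b] _ _ /=; exact: (proj2 (RP t Pt)).
Qed.

Lemma small_empty {T : Type} {X : T -> Prop} : (forall x, ~ X x) -> small (set_type X).
Proof.
by move=> e; apply: small_le uncK; exists (fun _ => 0) => -[x Xx]; case: (e x).
Qed.

Lemma small_sub {T : Type} {X Y : T -> Prop} :
  (forall x, X x -> Y x) -> small (set_type Y) -> small (set_type X).
Proof. by move=> s; apply: small_le; exact: inj_le_sub. Qed.

Lemma big_sub {X Y : K -> Prop} : (forall x, X x -> Y x) -> big X -> big Y.
Proof. by move=> s b; exact: inj_le_trans b (inj_le_sub s). Qed.

Lemma small_or {T : Type} {X Y : T -> Prop} :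
  small (set_type X) -> small (set_type Y) -> small {x | X x \/ Y x}.
Proof.
move=> sX sY; apply: small_le (small_sum sX sY).
apply: (inj_le_relS (fun x u => match u with
  inl a => x = proj1_sig a | inr b => x = proj1_sig b end)).
- by move=> x [h|h]; [exists (inl (exist _ x h))|exists (inr (exist _ x h))].
- by move=> x y [u|u] _ _ -> ->.
Qed.

Lemma big_or {X Y : K -> Prop} : big (fun x => X x \/ Y x) -> big X \/ big Y.
Proof.
move=> b; apply: NNPP => N.
have sX : ~ big X by tauto.
have sY : ~ big Y by tauto.
exact: small_or sX sY b.
Qed.

Lemma big_split {X : K -> Prop} (Y : K -> Prop) :
  big X -> big (fun x => X x /\ Y x) \/ big (fun x => X x /\ ~ Y x).
Proof.
move=> b; apply: big_or; apply: big_sub b => x Xx.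
by case: (classic (Y x)); auto.
Qed.

Lemma big_all : big (fun _ => True).
Proof. by exists (fun k => exist _ k I) => x y []. Qed.

End Small.

(** * Sets of size less than cf(kappa), and regularity of cf(kappa) *)

Section Cofinality.
Context {K : Type} {lt : K -> K -> Prop} (hK : is_cardinal lt).
Context {C : Type} (hC : is_cofinality lt C).
Context (natC : ~ inj_le C nat) (CK : ~ inj_le K C).

Let wo : strict_well_order lt := proj1 hK.

Definition few (I : Type) : Prop := ~ inj_le C I.

Lemma uncountable_K : ~ inj_le K nat.
Proof. by move=> H; apply: CK; apply: inj_le_trans H _; exact: inj_le_of_not. Qed.
Let uncK := uncountable_K.

Lemma few_le {A B : Type} : inj_le A B -> few B -> few A.
Proof. by move=> AB fB CA; apply: fB; exact: inj_le_trans CA AB. Qed.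

Lemma few_sub {T : Type} {X Y : T -> Prop} :
  (forall x, X x -> Y x) -> few (set_type Y) -> few (set_type X).
Proof. by move=> s; apply: few_le; exact: inj_le_sub. Qed.

Lemma inj_le_C_K : inj_le C K.
Proof. by case: hC => -[A [_ [CA _]]] _; apply: inj_le_trans CA _; exact: inj_le_set. Qed.

Lemma few_small {I : Type} : few I -> @small K I.
Proof. by move=> fI KI; apply: fI; exact: inj_le_trans inj_le_C_K KI. Qed.

Lemma inhabited_K : inhabited K.
Proof.
apply: NNPP => N; apply: uncK; exists (fun _ => 0) => x; case: N; exact: inhabits x.
Qed.

Lemma lt_unbounded (k : K) : exists y, lt k y.
Proof.
apply: NNPP => N; apply: (small_closed_seg hK uncK k).
have H x : ~ lt k x by move=> h; apply: N; exists x.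
by exists (fun x => exist _ x (H x)) => x y [].
Qed.

Lemma cofinal_map : exists a : C -> K, forall k, exists c, lt k (a c).
Proof.
case: hC => -[A [cofA [_ [g gi]]]] _.
pose a c := epsilon inhabited_K (fun y => exists h : A y, g (exist _ y h) = c).
exists a => k; have [k' kk'] := lt_unbounded k.
have [y [Ay yk']] := cofA k'.
exists (g (exist _ y Ay)).
have [Az e] := epsilon_spec inhabited_K
  (fun z => exists h : A z, g (exist _ z h) = g (exist _ y Ay))
  (ex_intro _ y (ex_intro _ Ay eq_refl)).
have -> : a (g (exist _ y Ay)) = y by move/gi: e => [].
exact: lt_nlt_trans wo _ _ _ kk' yk'.
Qed.

Lemma few_bounded {I : Type} (f : I -> K) : few I -> exists b, forall i, lt (f i) b.
Proof.
move=> fI; pose X y := exists i, y = f i.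
have nX : ~ cofinal lt X.
  move=> cX; apply: fI; apply: inj_le_trans (proj2 hC X cX) _.
  by apply: (inj_le_relS (fun y i => y = f i)) => // y y' i _ _ -> ->.
have [b bP] := not_all_ex_not _ _ nX.
by exists b => i; apply: NNPP => N; apply: bP; exists (f i); split=> //; exists i.
Qed.

Lemma few_boundedS {T : Type} {P : T -> Prop} (R : T -> K -> Prop) :
  few (set_type P) -> (forall t, P t -> exists k, R t k) ->
  (forall t k k', ~ lt k' k -> R t k -> R t k') ->
  exists k, forall t, P t -> R t k.
Proof.
move=> fP tot mono.
pose f (u : set_type P) := epsilon inhabited_K (R (proj1_sig u)).
have [b bP] := few_bounded f fP.
exists b => t Pt; apply: (mono t (f (exist _ t Pt))).
- apply: (wo_asym wo); exact: bP.
- apply: (epsilon_spec inhabited_K (R t)); exact: tot.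
Qed.

Lemma few_union_small {T : Type} {P : T -> Prop} (S : T -> K -> Prop) :
  few (set_type P) -> (forall t, P t -> @small K (set_type (S t))) ->
  @small K {x | exists t, P t /\ S t x}.
Proof.
move=> fP sS.
have [||b bP] := few_boundedS (fun t k => inj_le (set_type (S t)) (seg lt k)) fP.
- by move=> t Pt; apply: (small_bounded hK); exact: sS.
- by move=> t k k' kk' H; apply: inj_le_trans H _; exact: seg_mono wo _ _ kk'.
exact: (small_union_le hK uncK S (few_small fP) (small_seg hK b) bP).
Qed.

Lemma few_nat : few nat. Proof. exact: natC. Qed.

(** Regularity of cf(kappa): if [g] embedded [C], the cofinal map [a] would be bounded on each of
    the few fibres of the first coordinate, hence on all of [C]. *)
Lemma few_sigma {T U : Type} {P : T -> Prop} (Q : T -> U -> Prop) :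
  few (set_type P) -> (forall t, P t -> few (set_type (Q t))) ->
  few {p : T * U | P (fst p) /\ Q (fst p) (snd p)}.
Proof.
move=> fP fQ [g gi].
have [a aP] := cofinal_map.
have [t Pt|t k k' kk' H c e|k kP] := few_boundedS
    (fun t k => forall c, fst (proj1_sig (g c)) = t -> lt (a c) k) fP.
- pose D c := fst (proj1_sig (g c)) = t.
  have fD : few (set_type D).
    apply: few_le (fQ t Pt).
    apply: (inj_le_relS (fun c u => snd (proj1_sig (g c)) = proj1_sig u)).
    - move=> c e; have [_] := proj2_sig (g c); rewrite e => Qc.
      by exists (exist _ _ Qc).
    - move=> c c' u e e' <- e2; apply: gi; apply: proj1_sig_inj.
      by move: e e' e2; rewrite /D; case: (proj1_sig (g c)) (proj1_sig (g c')) => x y [x' y'] /= -> -> ->.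
  have [b bP] := few_bounded (fun u : set_type D => a (proj1_sig u)) fD.
  by exists b => c e; exact: (bP (exist _ c e)).
- exact: lt_nlt_trans wo _ _ _ (H c e) kk'.
- have [c kc] := aP k.
  apply: (wo_asym wo _ _ kc); apply: kP (eq_refl _).
  by case: (proj2_sig (g c)).
Qed.

Lemma few_union {T U : Type} {P : T -> Prop} (Q : T -> U -> Prop) :
  few (set_type P) -> (forall t, P t -> few (set_type (Q t))) ->
  few {u | exists t, P t /\ Q t u}.
Proof.
move=> fP fQ; apply: few_le (few_sigma Q fP fQ).
apply: (inj_le_relS (fun u p => snd (proj1_sig p) = u)).
- by move=> u [t [Pt Qu]]; exists (exist _ (t, u) (conj Pt Qu)).
- by move=> u u' p _ _ -> ->.
Qed.

Lemma few_or {U : Type} {X Y : U -> Prop} :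
  few (set_type X) -> few (set_type Y) -> few {u | X u \/ Y u}.
Proof.
move=> fX fY.
have fb : few {b : bool | True}.
  apply: few_le few_nat; exists (fun b : {b : bool | True} => Nat.b2n (proj1_sig b)).
  by case=> -[] [] [[] []].
apply: few_sub (few_union (fun b : bool => match b with true => X | false => Y end) fb _).
- by move=> u [h|h]; [exists true|exists false].
- by case.
Qed.

Lemma few_single {U : Type} (v : U) : few {u | u = v}.
Proof.
apply: few_le few_nat; exists (fun _ => 0) => -[u eu] [u' eu'] _.
by apply: proj1_sig_inj => /=; rewrite eu eu'.
Qed.

(** Otherwise every segment embeds in [S]. Coding [x] by some [c] with [x] below [a c], and by its
    image under the embedding of that segment, puts [K] into the small set [C * S]. *)
Lemma small_exceeded {S : Type} : @small K S -> exists k, ~ inj_le (seg lt k) S.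
Proof.
move=> sS; apply: NNPP => N.
have H k : exists g : K -> S, forall x y, lt x k -> lt y k -> g x = g y -> x = y.
  have [g gi] : inj_le (seg lt k) S by apply: NNPP => M'; apply: N; exists k.
  have [s0] : inhabited S.
    have [k1] := inhabited_K; have [k2 h] := lt_unbounded k1.
    apply: NNPP => M; apply: N; exists k2 => -[g' _].
    exact: M (inhabits (g' (exist _ k1 h))).
  exists (fun x => match excluded_middle_informative (lt x k) with
    | left h => g (exist _ x h) | right _ => s0 end) => x y xk yk.
  case: excluded_middle_informative => // h.
  by case: excluded_middle_informative => // h' /gi [].
have [g gP] := choice _ H.
have [a aP] := cofinal_map.
apply: (small_prod hK uncK CK sS).
apply: (inj_le_rel (fun x u => lt x (a (fst u)) /\ g (a (fst u)) x = snd u)).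
- by move=> x; have [c h] := aP x; exists (c, g (a c) x).
- by move=> x x' [c s] /= [h <-] [h' e]; symmetry in e; exact: gP h h' e.
Qed.

(** The set consists of the record values of a cofinal map on [C] in initial order: those not above
    [k] occur before any index whose value exceeds [k]. *)
Lemma thin_cofinal_set : exists A : K -> Prop,
  (forall k, exists i, A i /\ lt k i) /\ (forall k, few {i | A i /\ ~ lt k i}) /\
  inj_le C (set_type A) /\ inj_le (set_type A) C.
Proof.
have [a aP] := cofinal_map.
have [ltC [woC cardC]] := initial_order C.
pose A i := exists c, i = a c /\ forall d, ltC d c -> lt (a d) (a c).
have cofA k : exists i, A i /\ lt k i.
  have [c [kc min]] := wo_min woC _ (aP k).
  exists (a c); split=> //; exists c; split=> // d dc.
  exact: nlt_lt_trans wo _ _ _ (min d dc) kc.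
exists A; split=> //; split; [move=> k|split].
- have [c0 kc0] := aP k.
  apply: few_le (cardC c0).
  apply: (inj_le_relS (fun i u => i = a (proj1_sig u))) => [i [[c [-> H]] ki]|i i' u _ _ -> -> //].
  have cc0 : ltC c c0.
    case: (wo_tri woC c c0) => [//|[e|h]]; case: ki; first by rewrite e.
    exact: wo_trans wo _ _ _ kc0 (H _ h).
  by exists (exist _ c cc0).
- apply: (proj2 hC) => k; have [i [Ai ki]] := cofA k.
  by exists i; split=> //; exact: wo_asym wo _ _ ki.
- apply: (inj_le_relS (fun i c => i = a c)) => [i [c [-> _]]|i i' c _ _ -> -> //].
  by exists c.
Qed.

End Cofinality.

(** * Subsets of order type kappa *)

Section OrderType.
Context {K : Type} {lt : K -> K -> Prop} (hK : is_cardinal lt).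
Let wo : strict_well_order lt := proj1 hK.

Lemma big_of_order_iso (X : K -> Prop) : order_iso_to_K lt X -> big X.
Proof.
case=> f [fX [_ mono]]; exists (fun k => exist _ (f k) (fX k)) => x y [] e.
case: (wo_tri wo x y) => [|[//|]] /mono; rewrite e => /(wo_irr wo) [].
Qed.

(** [f k] is the least member of [X] above all earlier values. If none were left at [k], sending a
    point of [X] to the first [j] with [f j] not below it would embed [X] in a segment; if [y] in
    [X] were missed, all values would lie below [y]. *)
Lemma order_iso_of_big (X : K -> Prop) : big X -> order_iso_to_K lt X.
Proof.
move=> bX.
case: (classic (inhabited K)) => [iK|nK]; last first.
  by exists (fun x => x); split; [|split] => x; case: nK.
pose nxt k (r : forall j, lt j k -> K) y := X y /\ forall j h, lt (r j h) y.
have [f fE] := wf_recursion wo (fun k r => epsilon iK (fun y => nxt k r y /\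
  forall z, lt z y -> ~ nxt k r z)).
pose N k y := X y /\ forall j, lt j k -> lt (f j) y.
have fN k : (exists y, N k y) -> N k (f k) /\ forall z, lt z (f k) -> ~ N k z.
  move=> E; rewrite [f k]fE; apply: (epsilon_spec iK (fun y => N k y /\
    forall z, lt z y -> ~ N k z)).
  exact: wo_min wo _ E.
have {}fN k : N k (f k) /\ forall z, lt z (f k) -> ~ N k z.
  elim: (wo_wf wo k) => {}k _ IH; apply: fN; apply: NNPP => M.
  have H x : X x -> exists j, lt j k /\ ~ lt (f j) x.
    move=> Xx; apply: NNPP => M'; apply: M; exists x; split=> // j jk.
    by apply: NNPP => h; apply: M'; exists j.
  apply: (proj2 hK k); apply: inj_le_trans bX _.
  apply: (inj_le_relS (fun x u => ~ lt (f (proj1_sig u)) x /\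
     forall i, lt i (proj1_sig u) -> lt (f i) x)).
  - move=> x Xx; have [j [[jk fj] min]] := wo_min wo _ (H x Xx).
    exists (exist _ j jk); split=> //= i ij; apply: NNPP => h.
    by apply: (min i ij); split=> //; exact: wo_trans wo _ _ _ ij jk.
  - have half x x' j : lt j k -> X x -> ~ lt (f j) x' -> (forall i, lt i j -> lt (f i) x) ->
        ~ lt x x'.
      move=> jk Xx fj' fi xx'; apply: (proj2 (IH j jk) x); last by split.
      exact: lt_nlt_trans wo _ _ _ xx' fj'.
    move=> x x' [j jk] Xx Xx' /= [h1 h2] [h1' h2'].
    case: (wo_tri wo x x') => [h|[//|h]].
    + by case: (half x x' j).
    + by case: (half x' x j).
have mono a b : lt a b -> lt (f a) (f b).
  by move=> ab; case: (fN b) => -[_ +] _; apply.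
exists f; split; [|split].
- by move=> x; case: (fN x) => -[].
- move=> y Xy; apply: NNPP => M.
  have fy k : lt (f k) y.
    elim: (wo_wf wo k) => {}k _ IH.
    have h : ~ lt y (f k) by move=> h; apply: (proj2 (fN k) y h).
    by case: (nlt_cases wo _ _ h) => // e; case: M; exists k.
  apply: (proj2 hK y); exists (fun k => exist _ (f k) (fy k)) => a b [] e.
  by case: (wo_tri wo a b) => [/mono|[//|/mono]]; rewrite e => /(wo_irr wo).
- move=> a b; split; first exact: mono.
  case: (wo_tri wo a b) => [//|[->|/mono h1 h2]]; first by move/(wo_irr wo).
  by case: (wo_asym wo _ _ h1 h2).
Qed.

End OrderType.

(** * Labels and descent *)

Section Labels.
Context {K : Type} {lt : K -> K -> Prop} (hK : is_cardinal lt).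
Context {C : Type} (hC : is_cofinality lt C).
Context (natC : ~ inj_le C nat) (CK : ~ inj_le K C).

Let wo : strict_well_order lt := proj1 hK.
Let uncK : ~ inj_le K nat := uncountable_K natC CK.

Definition proper (f : K -> K) (X : K -> Prop) : Prop :=
  forall k, @small K {x | X x /\ ~ lt k (f x)}.

Lemma proper_sub f (X Y : K -> Prop) : (forall x, X x -> Y x) -> proper f Y -> proper f X.
Proof. by move=> s p k; apply: small_sub (p k) => x [Xx h]; split; auto. Qed.

(* [dom d] stands for the complement of a club [D] of [K], and [regr d x] for
   [sup (D /\ x)]; the clubs decrease modulo bounded sets along [label_lt]. *)
Record label_system : Type := LabelSystem {
  label : Type;
  label_lt : label -> label -> Prop;
  label_wo : strict_well_order label_lt;
  dom : label -> K -> Prop;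
  regr : label -> K -> K;
  dom_mono : forall e d, label_lt e d -> exists k, forall x, lt k x -> dom e x -> dom d x;
  regr_lt : forall d x, dom d x -> lt (regr d x) x;
  regr_proper : forall d k, exists k', forall x, dom d x -> ~ lt k (regr d x) -> ~ lt k' x;
  dom_big : forall (X : K -> Prop) f, big X -> proper f X ->
    exists d, big (fun x => X x /\ dom d (f x))
}.

Definition mono (h : K -> K) : Prop := forall a b, ~ lt b a -> ~ lt (h b) (h a).
Definition unclosed (h : K -> K) (x : K) : Prop := exists y, lt y x /\ ~ lt (h y) x.

(** [h y] is the least [b] such that at least |y| points of [X] have value above [y] and at most
    [b]. If there were no such [b], the points with value above [y] would form |C| sets of size at
    most |y|, and [X] would be small. *)
Lemma unclosed_big (X : K -> Prop) (f : K -> K) : big X -> proper f X ->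
  exists h, mono h /\ forall y,
    inj_le (seg lt y) {x | X x /\ lt y (f x) /\ ~ lt (h y) (f x)}.
Proof.
move=> bX pX.
pose I y b := inj_le (seg lt y) {x | X x /\ lt y (f x) /\ ~ lt b (f x)}.
have exI y : exists b, I y b.
  apply: NNPP => N; have [a aP] := cofinal_map hK hC natC CK.
  have small_above : @small K {x | exists c, True /\ X x /\ lt y (f x) /\ ~ lt (a c) (f x)}.
    apply: (small_union_le hK uncK (fun c x => X x /\ lt y (f x) /\ ~ lt (a c) (f x))
      (B := seg lt y)) => [||c _].
    - by apply: (@small_le K _ C) => //; exact: inj_le_set.
    - exact: small_seg.
    - by apply: inj_le_of_not => H; apply: N; exists (a c).
  apply: (small_or hK uncK (pX y) small_above); apply: big_sub bX => x Xx.
  case: (classic (lt y (f x))) => h; last by left.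
  by right; have [c hc] := aP (f x); exists c; split=> //; split=> //; split=> //; exact: wo_asym wo _ _ hc.
pose h y := epsilon (inhabited_K natC CK) (fun b => I y b /\ forall b', lt b' b -> ~ I y b').
have hP y : I y (h y) /\ forall b', lt b' (h y) -> ~ I y b'.
  apply: (epsilon_spec (inhabited_K natC CK) (fun b => I y b /\ forall b', lt b' b -> ~ I y b')).
  exact: wo_min wo _ (exI y).
exists h; split=> [y z yz lt_h|y]; last by case: (hP y).
apply: (proj2 (hP y) _ lt_h); apply: inj_le_trans (seg_mono wo _ _ yz) _.
apply: inj_le_trans (proj1 (hP z)) _; apply: inj_le_sub => x [Xx [zx hx]].
by do 2 split=> //; exact: nlt_lt_trans wo _ _ _ yz zx.
Qed.

(** In terms of clubs: that of [h] is contained in that of [h'] up to a bounded set. *)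
Definition unclosed_below (h' h : K -> K) : Prop :=
  exists k, forall x, lt k x -> unclosed h' x -> unclosed h x.

(** Let the segment of [k] not embed in the small set, and let [x] above [k] be closed under [h] but
    not under [h'], as seen at [y]. With [z] the larger of [k] and [y], the at least |k| points with
    value above [z] and at most [h z] have value between [y] and [x], so unclosed under [h']. *)
Lemma unclosed_below_of_small (X : K -> Prop) (f h h' : K -> K) :
  (forall y, inj_le (seg lt y) {x | X x /\ lt y (f x) /\ ~ lt (h y) (f x)}) ->
  @small K {x | X x /\ unclosed h' (f x)} -> unclosed_below h' h.
Proof.
move=> H sX; have [k kP] := small_exceeded hK hC natC CK sX.
exists k => x kx [y [yx hyx]]; apply: NNPP => N.
have [z [zk [zy zE]]] := wo_max wo k y.
have zx : lt z x by case: zE => ->.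
have hzx : lt (h z) x by apply: NNPP => M; apply: N; exists z.
apply: kP; apply: inj_le_trans (seg_mono wo _ _ zk) _.
apply: inj_le_trans (H z) _; apply: inj_le_sub => u [Xu [zu uh]]; split=> //.
exists y; split; first exact: nlt_lt_trans wo _ _ _ zy zu.
move=> h'u; apply: hyx; apply: (wo_trans wo _ _ _ h'u).
exact: nlt_lt_trans wo _ _ _ uh hzx.
Qed.

(* A label is a function [h], standing for the club of points closed under [h];
   [h] is kept iff its club is almost contained in all those kept before it, so that
   a club almost contained in all the kept ones is itself kept. *)
Lemma label_system_exists : inhabited label_system.
Proof.
have [ltF woF] := zermelo (K -> K).
have [kept keptE] := wf_recursion woF (A := Prop) (fun h kept =>
  mono h /\ forall h' (l : ltF h' h), kept h' l -> unclosed_below h' h).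
have iK := inhabited_K natC CK.
pose rg (d : set_type kept) x := epsilon iK (fun y => lt y x /\ ~ lt (proj1_sig d y) x).
have rgP d x : unclosed (proj1_sig d) x -> lt (rg d x) x /\ ~ lt (proj1_sig d (rg d x)) x.
  exact: (epsilon_spec iK (fun y => lt y x /\ ~ lt (proj1_sig d y) x)).
constructor; apply: (LabelSystem (set_type kept)
  (fun e d => ltF (proj1_sig e) (proj1_sig d)) _ (fun d => unclosed (proj1_sig d)) rg).
- exact: (wo_pullback woF (@proj1_sig _ kept) (@proj1_sig_inj _ _)).
- by case=> e ke [d kd] /= ed; move: (kd); rewrite keptE => -[_]; apply.
- by move=> d x /rgP [].
- move=> [d kd] k; have md : mono d by have := kd; rewrite {1}keptE => -[].
  exists (d k) => x /rgP [h1 h2] kr dx; apply: h2 => /=.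
  exact: nlt_lt_trans wo _ _ _ (md _ _ kr) dx.
- move=> X f bX pX; apply: NNPP => N.
  have [h [mh hP]] := unclosed_big X f bX pX.
  have kh : kept h.
    rewrite keptE; split=> // h' l kh'; apply: (unclosed_below_of_small X f h h' hP) => B.
    by apply: N; exists (exist _ h' kh').
  (* The new label itself serves: a value above [k] and at most [h k] is unclosed at [k], and at
     least |k| points have such a value. *)
  apply: N; exists (exist _ h kh); apply: NNPP => S.
  have [k kP] := small_exceeded hK hC natC CK S.
  apply: kP; apply: inj_le_trans (hP k) _; apply: inj_le_sub => x [Xx [kx hx]].
  by split=> //; exists k.
Qed.

End Labels.

(** * Types of big sets *)

Section Types.
Context {K : Type} {lt : K -> K -> Prop} (hK : is_cardinal lt).
Context {C : Type} (hC : is_cofinality lt C).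
Context (natC : ~ inj_le C nat) (CK : ~ inj_le K C).
Context (S : @label_system K lt).

Let wo : strict_well_order lt := proj1 hK.
Let uncK : ~ inj_le K nat := uncountable_K natC CK.
Let woL : strict_well_order (label_lt S) := label_wo S.

Fixpoint pull (s : list (label S)) (x : K) : K :=
  match s with nil => x | d :: s => regr S d (pull s x) end.

(** Both clauses pass to subsets, so the label of a set is also that of its big subsets. *)
Definition lab (f : K -> K) (X : K -> Prop) (d : label S) : Prop :=
  @small K {x | X x /\ ~ dom S d (f x)} /\
  forall e, label_lt S e d -> @small K {x | X x /\ dom S e (f x)}.

(* [typ s X]: [X] decides the first [length s] labels, the last one being the head
   of [s]; the corresponding function is [pull s]. *)
Fixpoint typ (s : list (label S)) (X : K -> Prop) : Prop :=
  match s with nil => True | d :: s => typ s X /\ lab (pull s) X d end.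

Definition labels (f : K -> K) (X : K -> Prop) (d : label S) : Prop :=
  exists Y, (forall x, Y x -> X x) /\ big Y /\ lab f Y d.

Lemma lab_sub f (X Y : K -> Prop) d : (forall x, X x -> Y x) -> lab f Y d -> lab f X d.
Proof.
move=> s [h1 h2]; split=> [|e ed]; first by apply: small_sub h1 => x [/s]; auto.
by apply: small_sub (h2 e ed) => x [/s]; auto.
Qed.

Lemma typ_sub s (X Y : K -> Prop) : (forall x, X x -> Y x) -> typ s Y -> typ s X.
Proof. by move=> h; elim: s => //= d s IH [/IH t]; split=> //; apply: lab_sub h _. Qed.

Lemma typ_proper s X : typ s X -> proper (lt := lt) (pull s) X.
Proof.
elim: s => [_|d s IH [/IH p [h _]]] k /=.
- by apply: small_sub (small_closed_seg hK uncK k) => x [].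
- have [k' k'P] := regr_proper S d k.
  apply: small_sub (small_or hK uncK h (p k')) => x [Xx r].
  case: (classic (dom S d (pull s x))) => D; last by left.
  by right; split=> //; exact: k'P.
Qed.

Lemma lab_unique f X d e : big X -> lab f X d -> lab f X e -> d = e.
Proof.
move=> bX; have H d1 d2 : lab f X d1 -> lab f X d2 -> ~ label_lt S d1 d2.
  move=> [h _] [_ h'] /h' l.
  by case: (big_split hK uncK (fun x => dom S d1 (f x)) bX).
by move=> ld le; case: (wo_tri woL d e) => [/H|[//|/H]] [].
Qed.

Lemma typ_unique X s s' : big X -> length s = length s' -> typ s X -> typ s' X -> s = s'.
Proof.
move=> bX; elim: s s' => [|d s IH] [|d' s'] //= [] e [t l] [t' l'].
have {}e := IH s' e t t'; subst s'; by rewrite (lab_unique _ _ _ _ bX l l').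
Qed.

Lemma labels_below f X d : big (fun x => X x /\ dom S d (f x)) ->
  exists e, ~ label_lt S d e /\ labels f X e.
Proof.
move=> b; have [e [be min]] := wo_min woL _
  (ex_intro (fun d => big (fun x => X x /\ dom S d (f x))) d b).
exists e; split; first by move=> /min.
exists (fun x => X x /\ dom S e (f x)); split; first by move=> x [].
split=> //; split=> [|d' /min N].
- by apply: (small_empty uncK) => x [[]].
- by apply: small_sub N => x [[]].
Qed.

(** * The tree of labels below a set with few labels at every stage *)

Section Tree.
Context (X : K -> Prop) (bX : big X).

(** A point goes to the first label of its node whose domain contains its current value, so siblings
    in the tree are disjoint. *)
Fixpoint node (s : list (label S)) (x : K) : Prop :=
  match s with
  | nil => X x
  | d :: s => node s x /\ dom S d (pull s x) /\
      forall e, label_lt S e d -> labels (pull s) (node s) e -> ~ dom S e (pull s x)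
  end.

Fixpoint in_tree (s : list (label S)) : Prop :=
  match s with nil => True | d :: s => in_tree s /\ labels (pull s) (node s) d end.

Definition leftover (s : list (label S)) (x : K) : Prop :=
  node s x /\ forall d, labels (pull s) (node s) d -> ~ node (d :: s) x.

Lemma node_sub s x : node s x -> X x.
Proof. by elim: s => [|d s IH] //= [/IH]. Qed.

Context (narrow : forall s Y, (forall x, Y x -> X x) -> big Y -> typ s Y ->
  few (C := C) (set_type (labels (pull s) Y))).

(** A set with label [d] loses only a small part to the few earlier labels, so the child is big. A
    big part of the child in an earlier domain would yield a label of the node before [d], whose
    domain the child avoids. *)
Lemma node_big_typ s : in_tree s -> big (node s) /\ typ s (node s).
Proof.
elim: s => [_|d s IH [/IH [b t] ld]]; first by split.
have fewL := narrow s (node s) (node_sub s) b t.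
split.
- have [Y [YX [bY [lY lY']]]] := ld.
  have sB : @small K {x | exists e, (labels (pull s) (node s) e /\ label_lt S e d) /\
      (Y x /\ dom S e (pull s x))}.
    apply: (few_union_small hK hC natC CK (fun e x => Y x /\ dom S e (pull s x))).
    - by apply: few_sub fewL => e [].
    - by move=> e [_ /lY'].
  apply: NNPP => sN; apply: (small_or hK uncK (small_or hK uncK lY sB) sN).
  apply: big_sub bY => x Yx.
  case: (classic (dom S d (pull s x))) => D; last by left; left.
  case: (classic (exists e, (labels (pull s) (node s) e /\ label_lt S e d) /\
      (Y x /\ dom S e (pull s x)))) => E; first by left; right.
  right; split; first exact: YX.
  by split=> // e ed le De; apply: E; exists e.
- split; first by apply: typ_sub t => x [].
  split=> [|e ed].
  + by apply: (small_empty uncK) => x [[_ []]].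
  + move=> B; have [d' [nd' [Z [ZX [bZ lZ]]]]] := labels_below (pull s) (node (d :: s)) e B.
    have d'd : label_lt S d' d by exact: nlt_lt_trans woL _ _ _ nd' ed.
    have ld' : labels (pull s) (node s) d'.
      by exists Z; split=> // x /ZX [].
    case: lZ => h _; apply: h; apply: big_sub bZ => x Zx; split=> //.
    by case: (ZX x Zx) => _ [_ H]; exact: H.
Qed.

(** A leftover avoids the domains of all labels of its node; were it big, [dom_big] would give some
    big part of it a label. *)
Lemma small_leftover s : in_tree s -> @small K (set_type (leftover s)).
Proof.
move=> /node_big_typ [b t] B.
pose R x := node s x /\ forall d, labels (pull s) (node s) d -> ~ dom S d (pull s x).
have bR : big R.
  apply: big_sub B => x [nx H]; split=> // d ld D.
  have [d' [[ld' D'] min]] := wo_min woL (fun d => labels (pull s) (node s) d /\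
    dom S d (pull s x)) (ex_intro _ d (conj ld D)).
  apply: (H d' ld'); do 2 split=> //.
  by move=> e /min N le De; apply: N.
have pR : proper (lt := lt) (pull s) R.
  by apply: proper_sub (typ_proper s _ t) => x [].
have [d bd] := dom_big S R (pull s) bR pR.
have [e [_ [Z [ZR [bZ lZ]]]]] := labels_below (pull s) R d bd.
have le : labels (pull s) (node s) e by exists Z; split=> // x /ZR [].
case: lZ => h _; apply: h; apply: big_sub bZ => x Zx; split=> //.
by case: (ZR x Zx) => _; apply.
Qed.

(** Each level is few by regularity, and the countably many levels are few since cf(kappa) is
    uncountable. *)
Lemma few_in_tree : few (C := C) (set_type in_tree).
Proof.
have level n : few (C := C) {s | in_tree s /\ length s = n}.
  elim: n => [|n IH].
  - apply: few_sub (few_single natC (@nil (label S))) => -[|d s] [] //.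
  - apply: few_le (few_sigma hK hC natC CK (fun s d => labels (pull s) (node s) d) IH _).
    + apply: (inj_le_relS (fun s p => s = snd (proj1_sig p) :: fst (proj1_sig p))).
      * case=> [|d s] [] // [ts ld] [] e.
        by exists (exist _ (s, d) (conj (conj ts e) ld)).
      * by move=> s s' p _ _ -> ->.
    + move=> s [/node_big_typ [b t] _]; exact: narrow (node_sub s) b t.
have fn : few (C := C) {n : nat | True}.
  by apply: few_le natC; exact: inj_le_set.
apply: few_sub (few_union hK hC natC CK (fun n s => in_tree s /\ length s = n) fn _) => // s ts.
by exists (length s).
Qed.

(* A point outside the leftovers follows an infinite branch of the tree, along which
   the values [pull s x] descend. *)
Lemma narrow_absurd : False.
Proof.
have sL := few_union_small hK hC natC CK leftover few_in_tree small_leftover.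
have [x [Xx N]] : exists x, X x /\ ~ exists s, in_tree s /\ leftover s x.
  apply: NNPP => M; apply: sL; apply: big_sub bX => x Xx.
  by apply: NNPP => h; apply: M; exists x.
have H y : forall s, in_tree s -> node s x -> pull s x = y -> False.
  elim: (wo_wf wo y) => {}y _ IH s ts nx e.
  apply: N; exists s; split=> //; split=> // d ld nd.
  apply: (IH (pull (d :: s) x) _ (d :: s)) => //.
  by rewrite -e; apply: regr_lt; case: nd => _ [].
exact: H nil I Xx eq_refl.
Qed.

End Tree.

Lemma many_labels X : big X -> exists s Y,
  (forall x, Y x -> X x) /\ big Y /\ typ s Y /\ inj_le C (set_type (labels (pull s) Y)).
Proof.
move=> bX; apply: NNPP => N; apply: (narrow_absurd X bX) => s Y YX bY tY H.
by apply: N; exists s, Y.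
Qed.

End Types.

(** * Almost disjoint families and names for elements of the power set *)

Section AlmostDisjoint.
Context {K : Type} {lt : K -> K -> Prop} (hK : is_cardinal lt).
Context {C : Type} (hC : is_cofinality lt C).
Context (natC : ~ inj_le C nat) (CK : ~ inj_le K C).

Let wo : strict_well_order lt := proj1 hK.
Let uncK : ~ inj_le K nat := uncountable_K natC CK.

Context (p : K -> K -> Prop) (p_disjoint : forall k k' x, p k x -> p k' x -> k = k').

Definition fat (Y : K -> Prop) : Prop :=
  forall k, exists k', ~ lt k' k /\ big (fun x => Y x /\ p k' x).

(** The bound |k| grows with the piece, so a thin set can be big although it is small below each
    index. *)
Definition thin (b : K -> Prop) : Prop :=
  (forall k, inj_le {x | b x /\ p k x} (seg lt k)) /\ (forall x, b x -> exists k, p k x).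

Lemma thin_small_below b : thin b ->
  forall k, @small K {x | b x /\ exists k', ~ lt k k' /\ p k' x}.
Proof.
move=> [tb _] k.
have H := small_union_le hK uncK (fun k' x => b x /\ p k' x)
  (small_closed_seg hK uncK k) (small_seg hK k).
apply: small_sub (H _) => [x [bx [k' [kk' px]]]|k' kk']; first by exists k'.
exact: inj_le_trans (tb k') (seg_mono wo _ _ kk').
Qed.

(** From each piece [k] in which [Y] is big take |k| points outside the [B n] with [e n] below [k]:
    these are at most |k| sets with at most |k| points in the piece. The result meets [B n] only in
    pieces up to [e n]. *)
Lemma thin_diagonal {N : Type} (B : N -> K -> Prop) (Y : K -> Prop) :
  inj_le N K -> (forall n, thin (B n)) -> fat Y ->
  exists b, (forall x, b x -> Y x) /\ big b /\ thin b /\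
    forall n, @small K {x | b x /\ B n x}.
Proof.
move=> [e ei] tB fY.
pose rem k x := Y x /\ p k x /\ forall n, lt (e n) k -> ~ B n x.
have big_rem k : big (fun x => Y x /\ p k x) -> big (rem k).
  move=> bY; case: (big_split hK uncK
      (fun x => exists n, lt (e n) k /\ (B n x /\ p k x)) bY) => [H|H].
  - have s : @small K {x | exists n, lt (e n) k /\ (B n x /\ p k x)}.
      apply: (small_union_le hK uncK (fun n x => B n x /\ p k x) _ (small_seg hK k)).
      + apply: small_le (small_seg hK k).
        apply: (inj_le_relS (fun n u => e n = proj1_sig u)) => [n h|n n' u _ _ <- /ei //].
        by exists (exist _ (e n) h).
      + by move=> n _; exact: (proj1 (tB n)).
    by case: s; apply: big_sub H => x [].
  - apply: big_sub H => x [[Yx px] h]; split=> //; split=> // n l Bx.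
    by apply: h; exists n.
have H k : exists G : K -> Prop, (forall x, G x -> rem k x) /\
    inj_le (set_type G) (seg lt k) /\
    (big (fun x => Y x /\ p k x) -> inj_le (seg lt k) (set_type G)).
  case: (classic (big (fun x => Y x /\ p k x))) => [/big_rem [g gi]|nb]; last first.
    exists (fun _ => False); do 2 split=> //.
    by apply: (inj_le_relS (fun _ _ => True)).
  exists (fun x => exists j, lt j k /\ x = proj1_sig (g j)); split; [|split=> [|_]].
  - by move=> x [j [_ ->]]; exact: (proj2_sig (g j)).
  - apply: (inj_le_relS (fun x u => x = proj1_sig (g (proj1_sig u)))).
    + by move=> x [j [jk ->]]; exists (exist _ j jk).
    + by move=> x x' u _ _ -> ->.
  - apply: (inj_le_relS (fun j u => proj1_sig (g j) = proj1_sig u)).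
    + by move=> j jk; exists (exist _ (proj1_sig (g j)) (ex_intro _ j (conj jk eq_refl))).
    + by move=> j j' u _ _ <- /proj1_sig_inj /gi.
have [G GP] := choice _ H.
exists (fun x => exists k, G k x).
have tb : thin (fun x => exists k, G k x).
  split=> [k|x [k /(proj1 (GP k)) [_ [px _]]]]; last by exists k.
  apply: inj_le_trans (proj1 (proj2 (GP k))); apply: inj_le_sub => x [[k' Gx] px].
  by have [_ [px' _]] := proj1 (GP k') x Gx; rewrite (p_disjoint _ _ _ px px').
split; first by move=> x [k /(proj1 (GP k)) []].
split; [|split=> // n].
- apply: NNPP => s; have [k kP] := small_exceeded hK hC natC CK s.
  have [k' [kk' bk']] := fY k.
  apply: kP; apply: inj_le_trans (seg_mono wo _ _ kk') _.
  apply: inj_le_trans (proj2 (proj2 (GP k')) bk') _.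
  by apply: inj_le_sub => x Gx; exists k'.
- apply: small_sub (thin_small_below _ tb (e n)) => x [[k Gx] Bx].
  split; first by exists k.
  have [_ [px h]] := proj1 (GP k) x Gx.
  by exists k; split=> // l; exact: h l Bx.
Qed.

Context {M : Type} {ltM : M -> M -> Prop} (woM : strict_well_order ltM).
Context (segM : forall m, inj_le (seg ltM m) K).
Context (en : M -> (K -> Prop) * M) (en_onto : forall q, exists m, en m = q).

(** Stage [m] serves the set and value in [en m] by a big thin subset almost disjoint from its at
    most kappa predecessors. *)
Lemma almost_disjoint_family (Q : (K -> Prop) -> Prop) :
  exists R : (K -> Prop) -> M -> Prop,
  (forall b r, R b r -> thin b /\ exists Y, Q Y /\ forall x, b x -> Y x) /\
  (forall Y, Q Y -> fat Y -> forall r, exists b, (forall x, b x -> Y x) /\ big b /\ R b r) /\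
  (forall b b' r r', R b r -> R b' r' -> big (fun x => b x /\ b' x) -> r = r').
Proof.
pose valid m := Q (fst (en m)) /\ fat (fst (en m)).
(* Stages whose set is not a fat member of [Q] contribute the empty set. *)
pose good m (r : forall j, ltM j m -> K -> Prop) (b : K -> Prop) :=
  (valid m -> (forall x, b x -> fst (en m) x) /\ big b /\ thin b /\
    forall j (l : ltM j m), @small K {x | b x /\ r j l x}) /\
  (~ valid m -> b = fun _ => False).
have [B BE] := wf_recursion woM (fun m r => epsilon (inhabits (fun _ => False)) (good m r)).
have BP m : thin (B m) /\ good m (fun j _ => B j) (B m).
  elim: (wo_wf woM m) => {}m _ IH.
  have g : good m (fun j _ => B j) (B m).
    rewrite BE; apply: (epsilon_spec (inhabits (fun _ => False)) (good m (fun j _ => B j))).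
    case: (classic (valid m)) => v; last by exists (fun _ => False).
    have [|b [h1 [h2 [h3 h4]]]] := thin_diagonal (fun u : seg ltM m => B (proj1_sig u))
      (fst (en m)) (segM m) _ (proj2 v).
    - by case=> j jm; case: (IH j jm).
    - exists b; split=> // _; do 3 split=> //.
      by move=> j l; exact: (h4 (exist _ j l)).
  split=> //; case: (classic (valid m)) => [/(proj1 g) [_ [_ []]] //|/(proj2 g) ->].
  by split=> // k; apply: (inj_le_relS (fun _ _ => True)) => [x [[]]|x x' u [[]]].
exists (fun b r => exists m, valid m /\ b = B m /\ r = snd (en m)); split; [|split].
- move=> b r [m [v [-> _]]]; case: (BP m) => t [/(_ v) [s _] _]; split=> //.
  by exists (fst (en m)); split=> //; case: v.
- move=> Y QY fY r; have [m em] := en_onto (Y, r).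
  have v : valid m by rewrite /valid em.
  case: (BP m) => _ [/(_ v) [s [b _]] _]; exists (B m).
  split; first by move: s; rewrite em.
  by split=> //; exists m; rewrite em.
- move=> b b' r r' [m [v [-> ->]]] [m' [v' [-> ->]]] bb.
  have H j i : valid i -> ltM j i -> @small K {x | B i x /\ B j x}.
    by move=> vi l; case: (BP i) => _ [/(_ vi) [_ [_ [_ /(_ j l) h]]] _].
  case: (wo_tri woM m m') => [l|[-> //|l]].
  + by case: (H m m' v' l); apply: big_sub bb => x [].
  + by case: (H m' m v l).
Qed.

End AlmostDisjoint.

(** * Ladders of labels and the names built from them *)

Section Names.
Context {K : Type} {lt : K -> K -> Prop} (hK : is_cardinal lt).
Context {C : Type} (hC : is_cofinality lt C).
Context (natC : ~ inj_le C nat) (CK : ~ inj_le K C).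
Context (S : @label_system K lt).

Let wo : strict_well_order lt := proj1 hK.
Let uncK : ~ inj_le K nat := uncountable_K natC CK.
Notation ltL := (label_lt S).
Let woL : strict_well_order ltL := label_wo S.

Context (A : K -> Prop) (cofA : forall k, exists i, A i /\ lt k i).
Context (fewA : forall k, few (C := C) {i | A i /\ ~ lt k i}).
Context (CA : inj_le C (set_type A)) (AC : inj_le (set_type A) C).

Definition ladder (D : label S -> Prop) (s : K -> label S) : Prop :=
  (forall a b, ~ lt b a -> ~ ltL (s b) (s a)) /\ (forall k, D (s k)) /\
  forall d, D d -> exists k, ~ ltL (s k) d.

(** Points are sorted by the first rung, at an index in [A], whose domain contains the value; [V]
    will be the domain of a limit label, or everything. *)
Definition piece (V : K -> Prop) (s : K -> label S) (f : K -> K) (k x : K) : Prop :=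
  A k /\ V (f x) /\ dom S (s k) (f x) /\
  forall k', lt k' k -> A k' -> ~ dom S (s k') (f x).

Lemma piece_disjoint V s f k k' x : piece V s f k x -> piece V s f k' x -> k = k'.
Proof.
move=> [Ak [_ [d h]]] [Ak' [_ [d' h']]]; case: (wo_tri wo k k') => [l|[//|l]].
- by case: (h' k l Ak).
- by case: (h k' l Ak').
Qed.

(** [s k] is the least member of [D] not below any label [g i] with [i] in [A] up to [k]. It exists
    because few labels of [J] are below one of these; a member of [D] beyond all rungs would have
    cf(kappa) labels of [J] below it. *)
Lemma ladder_exists (D J : label S -> Prop) :
  (forall d, D d -> few (C := C) {e | J e /\ ltL e d}) ->
  inj_le C {e | J e /\ D e} -> exists s, ladder D s.
Proof.
move=> fJ CJ; have [g gi] := inj_le_trans AC CJ.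
pose ub k d := D d /\ forall i (h : A i), ~ lt k i -> ~ ltL d (proj1_sig (g (exist _ i h))).
have gJ u : J (proj1_sig (g u)) by case: (proj2_sig (g u)).
have gD u : D (proj1_sig (g u)) by case: (proj2_sig (g u)).
have exub k : exists d, ub k d.
  apply: NNPP => N.
  apply: (few_union hK hC natC CK (fun i e => exists h : A i, J e /\
      ltL e (proj1_sig (g (exist _ i h)))) (fewA k) _).
  - move=> i [Ai _]; apply: few_sub (fJ _ (gD (exist _ i Ai))) => e [h].
    by rewrite (proof_irrelevance _ Ai h).
  - apply: inj_le_trans CJ _; apply: inj_le_sub => d [Jd Dd].
    apply: NNPP => N'; apply: N; exists d; split=> // i h ki l; apply: N'.
    by exists i; split=> //; exists h.
have [s sP] := choice _ (fun k => wo_min woL _ (exub k)).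
exists s; split; [|split].
- move=> a b ab l; case: (sP b) => -[Db ubb] _.
  case: (sP a) => _ /(_ _ l); apply; split=> // i h ai; apply: ubb.
  exact: nlt_trans wo _ _ _ ai ab.
- by move=> k; case: (sP k) => -[].
- move=> d Dd; apply: NNPP => N; apply: (fJ d Dd).
  apply: inj_le_trans CA _.
  apply: (inj_le_rel (fun u v => proj1_sig (g u) = proj1_sig v)).
  + move=> [i h]; suff l : ltL (proj1_sig (g (exist _ i h))) d.
      by exists (exist (fun e => J e /\ ltL e d) _ (conj (gJ (exist _ i h)) l)).
    apply: NNPP => nl; apply: N; exists i => l'.
    case: (sP i) => -[_ /(_ i h (wo_irr wo i)) n] _; apply: n.
    exact: lt_nlt_trans woL _ _ _ l' nl.
  + by move=> u u' v <- /proj1_sig_inj /gi.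
Qed.

Lemma dom_le e d : ~ ltL d e -> exists k, forall x, lt k x -> dom S e x -> dom S d x.
Proof.
case/(nlt_cases woL) => [/(dom_mono S) //|->].
by have [k] := inhabited_K natC CK; exists k.
Qed.

Lemma ladder_cofinal D s k d : ladder D s -> D d ->
  exists i, A i /\ lt k i /\ ~ ltL (s i) d.
Proof.
move=> [mono [_ cof]] /cof [k' h].
have [m [km [k'm _]]] := wo_max wo k k'.
have [i [Ai mi]] := cofA m.
exists i; split=> //; split; first exact: nlt_lt_trans wo _ _ _ km mi.
apply: (nlt_trans woL _ _ _ h); apply: mono.
apply: (wo_asym wo); exact: nlt_lt_trans wo _ _ _ k'm mi.
Qed.

(** Take a big [Z] in [Y] with label [e] beyond [s k], and a rung [s i] not before [e]. Almost all
    of [Z] lies in the few pieces up to [i] and almost none in those before [k], so a piece from [k]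
    on is big in [Y]. *)
Lemma fat_pieces D s V f Y : ladder D s -> proper (lt := lt) f Y ->
  (forall d, D d -> exists k, forall x, lt k x -> dom S d x -> V x) ->
  (forall d, D d -> exists e, D e /\ ltL d e /\ labels S f Y e) ->
  fat (lt := lt) (piece V s f) Y.
Proof.
move=> lad pY DV lim k; apply: NNPP => N.
have [e [De [ske [Z [ZY [bZ [lZ lZ']]]]]]] := lim (s k) (proj1 (proj2 lad) k).
have pZ := proper_sub f Z Y ZY pY.
have [i [Ai [_ ei]]] := ladder_cofinal D s k e lad De.
have [k2 k2P] := dom_le _ _ ei.
have [k3 k3P] := DV e De.
have sZ := few_union_small hK hC natC CK (P := fun j => A j /\ ~ lt i j)
  (fun j x => Z x /\ piece V s f j x) (fewA i).
have {}sZ : @small K {x | exists j, (A j /\ ~ lt i j) /\ (Z x /\ piece V s f j x)}.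
  apply: sZ => j _; case: (classic (lt j k)) => jk.
  - have l : ltL (s j) e.
      exact: nlt_lt_trans woL _ _ _ (proj1 lad j k (wo_asym wo _ _ jk)) ske.
    by apply: small_sub (lZ' _ l) => x [Zx [_ [_ [d _]]]].
  - move=> B; apply: N; exists j; split=> //.
    by apply: big_sub B => x [/ZY].
apply: (small_or hK uncK (small_or hK uncK lZ (pZ k2))
  (small_or hK uncK (pZ k3) sZ)).
apply: big_sub bZ => x Zx.
case: (classic (dom S e (f x))) => de; last by left; left.
case: (classic (lt k2 (f x))) => h2; last by left; right.
case: (classic (lt k3 (f x))) => h3; last by right; left.
right; right.
have [j [[Aj dj] min]] := wo_min wo (fun j => A j /\ dom S (s j) (f x))
  (ex_intro _ i (conj Ai (k2P _ h2 de))).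
exists j; split; first by split=> // ij; apply: (min i ij); split=> //; exact: k2P.
split=> //; split=> //; split; first exact: k3P.
by split=> // k' l Ak' d'; exact: (min k' l).
Qed.

(** Past a bound, values in [dom S d] lie in the domain of some rung [s i], so their points are in
    pieces up to [i], where a thin set is small. *)
Lemma thin_label_small D s V f b d : ladder D s -> proper (lt := lt) f b ->
  thin (lt := lt) (piece V s f) b -> D d -> @small K {x | b x /\ dom S d (f x)}.
Proof.
move=> lad pb tb Dd; have [k] := inhabited_K natC CK.
have [i [Ai [_ di]]] := ladder_cofinal D s k d lad Dd.
have [k2 k2P] := dom_le _ _ di.
apply: small_sub (small_or hK uncK (pb k2) (thin_small_below hK natC CK _ _ tb i)).
move=> x [bx dx]; case: (classic (lt k2 (f x))) => h2; last by left.
right; split=> //; have [j pj] := proj2 tb x bx.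
exists j; split=> // ij; case: pj => _ [_ [_ /(_ i ij Ai)]]; apply; exact: k2P.
Qed.

Lemma fat_label f Y : big Y -> proper (lt := lt) f Y ->
  inj_le C (set_type (labels S f Y)) ->
  exists d, (exists s, ladder (fun e => ltL e d) s) /\
    forall s, ladder (fun e => ltL e d) s -> fat (lt := lt) (piece (dom S d) s f) Y.
Proof.
move=> bY pY CJ.
(* The limit label is the first one with [cf(kappa)] labels of [Y] below it. It
   exists, as otherwise a thin subset of [Y] would have no label at all. *)
pose D d := few (C := C) {e | labels S f Y e /\ ltL e d}.
have lim (D' : label S -> Prop) d : inj_le C {e | labels S f Y e /\ D' e} -> D d ->
    exists e, D' e /\ ltL d e /\ labels S f Y e.
  move=> CJ' Dd; apply: NNPP => N.
  apply: (few_or hK hC natC CK Dd (few_single natC d)).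
  apply: inj_le_trans CJ' _; apply: inj_le_sub => e [le De].
  case: (wo_tri woL d e) => [de|[->|ed]]; [|by right|by left].
  by case: N; exists e.
have [d Nd] : exists d, ~ D d.
  apply: NNPP => N.
  have allD d : D d by apply: NNPP => Nd; apply: N; exists d.
  have CJ' : inj_le C {e | labels S f Y e /\ D e}.
    by apply: inj_le_trans CJ _; apply: inj_le_sub.
  have [s lad] := ladder_exists D _ (fun d h => h) CJ'.
  have fY : fat (lt := lt) (piece (fun _ => True) s f) Y.
    apply: (fat_pieces D) lad pY _ _ => d Dd; last exact: lim.
    by have [k] := inhabited_K natC CK; exists k.
  (* Diagonalizing against the empty family extracts a big thin subset of [Y]. *)
  have inj0 : inj_le False K by exists (fun n : False => match n with end) => -[].
  have [b [bsub [bb [tb _]]]] := thin_diagonal hK hC natC CK _ (piece_disjoint _ s f)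
    (fun (n : False) => match n with end) Y inj0 (fun n : False => match n with end) fY.
  have pb := proper_sub f b Y bsub pY.
  have [d bd] := dom_big S b f bb pb.
  exact: (thin_label_small D s _ f b d lad pb tb (allD d)) bd.
have [{}d [{}Nd min]] := wo_min woL _ (ex_intro (fun d => ~ D d) d Nd).
have DL e : ltL e d -> D e by move=> ed; apply: NNPP; exact: min.
have CJ' : inj_le C {e | labels S f Y e /\ ltL e d} by exact: NNPP.
exists d; split; first exact: ladder_exists DL CJ'.
move=> s lad; apply: (fat_pieces _ s _ f Y lad pY) => [e ed|e /DL De].
- exact: (dom_mono S).
- exact: lim.
Qed.

Context {M : Type} {ltM : M -> M -> Prop} (woM : strict_well_order ltM).
Context (segM : forall m, inj_le (seg ltM m) K).
Context (en : M -> (K -> Prop) * M) (en_onto : forall q, exists m, en m = q).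

(* [t n b r] reads: [b] forces the [n]-th value of the generic sequence to be [r]. *)
Lemma collapsing_names_of_labels : exists t : nat -> (K -> Prop) -> M -> Prop,
  (forall n b b' r r', t n b r -> t n b' r' -> big (fun x => b x /\ b' x) -> r = r') /\
  forall X, big X -> exists n, forall r, exists b, (forall x, b x -> X x) /\ big b /\ t n b r.
Proof.
(* One ladder is fixed for each label that has one; the constant default is not a ladder, and [t]
   below asks for one. *)
have [lad ladP] : exists lad : label S -> K -> label S, forall d,
    (exists s, ladder (fun e => ltL e d) s) -> ladder (fun e => ltL e d) (lad d).
  apply: (choice (fun d s => (exists s, ladder (fun e => ltL e d) s) ->
    ladder (fun e => ltL e d) s)) => d.
  case: (classic (exists s, ladder (fun e => ltL e d) s)) => [[s h]|N].
  - by exists s.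
  - by exists (fun _ => d).
pose p (sd : list (label S) * label S) := piece (dom S (snd sd)) (lad (snd sd)) (pull S (fst sd)).
have [R RP] := choice _ (fun sd => almost_disjoint_family hK hC natC CK (p sd)
  (piece_disjoint _ _ _) woM segM en en_onto (typ S (fst sd))).
exists (fun n b r => exists s d, length s = n /\ ladder (fun e => ltL e d) (lad d) /\ R (s, d) b r).
split.
- move=> n b b' r r' [s [d [sn [ld Rb]]]] [s' [d' [sn' [ld' Rb']]]] bb.
  (* Members of the family of [(s0, d0)] have type [s0] and label [d0], which pass to the common
     part; so compatible members of the same level come from one family. *)
  have H s0 d0 b0 r0 : ladder (fun e => ltL e d0) (lad d0) -> R (s0, d0) b0 r0 ->
      (forall x, b x /\ b' x -> b0 x) ->
      typ S s0 (fun x => b x /\ b' x) /\ lab S (pull S s0) (fun x => b x /\ b' x) d0.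
    move=> l0 /(proj1 (RP _)) [tb [Y [tY bY]]] sub.
    have tb0 := typ_sub S _ _ _ bY tY.
    split; first exact: typ_sub S _ _ _ sub tb0.
    apply: lab_sub sub _; split=> [|e ed].
    + apply: (small_empty uncK) => x [bx]; apply.
      by have [k [_ [h _]]] := proj2 tb x bx.
    + exact: (thin_label_small _ (lad d0) _ _ _ e l0 (typ_proper hK natC CK S _ _ tb0) tb ed).
  have [t l] := H s d b r ld Rb (fun x h => proj1 h).
  have [t' l'] := H s' d' b' r' ld' Rb' (fun x h => proj2 h).
  have es : s = s' by apply: (typ_unique hK natC CK S _ _ _ bb) t t'; rewrite sn sn'.
  subst s'; have ed := lab_unique hK natC CK S _ _ _ _ bb l l'; subst d'.
  exact: (proj2 (proj2 (RP (s, d)))) Rb Rb' bb.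
- move=> X bX; have [s [Y [YX [bY [tY CJ]]]]] := many_labels hK hC natC CK S X bX.
  have [d [ex fd]] := fat_label (pull S s) Y bY (typ_proper hK natC CK S _ _ tY) CJ.
  exists (length s) => r.
  have [b [bsub [bb Rb]]] := proj1 (proj2 (RP (s, d))) Y tY (fd _ (ladP d ex)) r.
  exists b; split; first by move=> x /bsub /YX.
  by split=> //; exists s, d; split=> //; split=> //; exact: ladP.
Qed.

End Names.

(** * Dense trees and Boolean completions *)

Section CantorBernstein.
Context {A B : Type} (f : A -> B) (g : B -> A).
Context (fi : forall x y, f x = f y -> x = y) (gi : forall x y, g x = g y -> x = y).

(** Points whose chain of preimages starts in [A] outside the range of [g]: there the bijection is
    [f], elsewhere the inverse of [g]. *)
Inductive outside_chain : A -> Prop :=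
| outside_base a : (forall b, g b <> a) -> outside_chain a
| outside_step a : outside_chain a -> outside_chain (g (f a)).

Lemma cantor_bernstein : exists h : A -> B,
  (forall x y, h x = h y -> x = y) /\ forall b, exists a, h a = b.
Proof.
have H a : exists b, (outside_chain a -> b = f a) /\ (~ outside_chain a -> g b = a).
  case: (classic (outside_chain a)) => c; first by exists (f a).
  case: (classic (exists b, g b = a)) => [[b e]|N]; first by exists b.
  by case: c; apply: outside_base => b e; apply: N; exists b.
have [h hP] := choice _ H.
have mix x y : outside_chain x -> ~ outside_chain y -> h x <> h y.
  move=> cx ncy e; apply: (ncy).
  by rewrite -(proj2 (hP y) ncy) -e (proj1 (hP x) cx); exact: outside_step.
exists h; split=> [x y e|b].
- case: (classic (outside_chain x)) (classic (outside_chain y)) => [cx|ncx] [cy|ncy].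
  + by apply: fi; rewrite -(proj1 (hP x) cx) -(proj1 (hP y) cy).
  + by case: (mix x y cx ncy).
  + by case: (mix y x cy ncx).
  + by rewrite -(proj2 (hP x) ncx) -(proj2 (hP y) ncy) e.
- case: (classic (outside_chain (g b))) => c; last first.
    by exists (g b); apply: gi; exact: (proj2 (hP _) c).
  move ea: (g b) c => a c; case: c ea => [a' N /N []|a' c /gi ->].
  by exists a'; exact: (proj1 (hP a') c).
Qed.

End CantorBernstein.

(** * A dense copy of the tree of finite sequences *)

Section Tree.
Context {K : Type}.
Context (t : nat -> (K -> Prop) -> (K -> Prop) -> Prop).
Context (t_fun : forall n b b' r r',
  t n b r -> t n b' r' -> big (fun x => b x /\ b' x) -> r = r').
Context (t_onto : forall X, big X -> exists n, forall r : K -> Prop,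
  exists b, (forall x, b x -> X x) /\ big b /\ t n b r).

(** Values are now read as subsets of [K]: [Y] decides whether the [n]-th named set is in the
    generic filter. *)
Definition decides (n : nat) (Y : K -> Prop) : Prop :=
  forall b r, t n b r -> big (fun x => Y x /\ b x) ->
    (forall x, Y x -> r x) \/ ~ big (fun x => Y x /\ r x).

Lemma decides_dense n X : big X -> exists Y, (forall x, Y x -> X x) /\ big Y /\ decides n Y.
Proof.
move=> bX.
case: (classic (exists b r, t n b r /\ big (fun x => X x /\ b x))) => [[b [r [tb bb]]]|N]; last first.
  by exists X; split=> //; split=> // b r tb bb; case: N; exists b, r.
have uniq Y b' r' : (forall x, Y x -> X x /\ b x) -> t n b' r' ->
    big (fun x => Y x /\ b' x) -> r' = r.
  move=> YX tb' bb'; apply: t_fun tb' tb _; apply: big_sub bb' => x [/YX []]; auto.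
case: (classic (big (fun x => (X x /\ b x) /\ r x))) => br.
- exists (fun x => (X x /\ b x) /\ r x); split; first by move=> x [[]].
  by split=> // b' r' tb' bb'; left; rewrite (uniq _ _ _ _ tb' bb') => x [].
- exists (fun x => X x /\ b x); split; first by move=> x [].
  by split=> // b' r' tb' bb'; right; rewrite (uniq _ _ _ _ tb' bb').
Qed.

Definition splits (n : nat) (X : K -> Prop) (c : (K -> Prop) -> K -> Prop) : Prop :=
  (forall m, (forall x, c m x -> X x) /\ big (c m) /\ decides n (c m)) /\
  (forall m m', big (fun x => c m x /\ c m' x) -> m = m') /\
  (forall Y, (forall x, Y x -> X x) -> big Y -> exists m, big (fun x => c m x /\ Y x)).

(** The 2^kappa values possible below [X] give incompatible sets [d r]. They are extended greedily
    to a maximal antichain, which Cantor-Bernstein indexes by [K -> Prop]. *)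
Lemma deciding_antichain n X : big X -> exists c, splits n X c.
Proof.
move=> bX.
have [k kP] := t_onto X bX.
pose good Y := (forall x, Y x -> X x) /\ big Y /\ decides n Y.
have [d dP] : exists d : (K -> Prop) -> K -> Prop, forall r,
    good (d r) /\ exists b, (forall x, d r x -> b x) /\ t k b r.
  apply: (choice (fun r d => good d /\ exists b, (forall x, d x -> b x) /\ t k b r)) => r.
  have [b [bX' [bb tb]]] := kP r; have [Y [Yb [bY dY]]] := decides_dense n b bb.
  exists Y; split; last by exists b.
  by split=> // x /Yb /bX'.
have d_inj r r' : big (fun x => d r x /\ d r' x) -> r = r'.
  case: (dP r) (dP r') => _ [b [db tb]] [_ [b' [db' tb']]] B; apply: t_fun tb tb' _.
  by apply: big_sub B => x [/db + /db'].
have [ltM woM] := zermelo (K -> Prop).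
have [kept keptE] := wf_recursion woM (A := Prop) (fun Y kept => good Y /\
  (forall r, ~ big (fun x => Y x /\ d r x)) /\
  forall Y' (l : ltM Y' Y), kept Y' l -> ~ big (fun x => Y x /\ Y' x)).
pose anti Y := (exists r, Y = d r) \/ kept Y.
have comm Y Z : big (fun x => Y x /\ Z x) -> big (fun x => Z x /\ Y x).
  by apply: big_sub => x [].
have anti_good Y : anti Y -> good Y.
  by case=> [[r ->]|]; [case: (dP r)|rewrite keptE => -[]].
have anti_inj Y Y' : anti Y -> anti Y' -> big (fun x => Y x /\ Y' x) -> Y = Y'.
  case=> [[r ->]|kY] [[r' ->]|kY'].
  - by move/d_inj ->.
  - by move/comm; move: kY'; rewrite keptE => -[_ [N _]] /N.
  - by move: kY; rewrite keptE => -[_ [N _]] /N.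
  - case: (wo_tri woM Y Y') => [l|[//|l]].
    + by move/comm; move: (kY'); rewrite keptE => -[_ [_ /(_ Y l kY) N]] /N.
    + by move: (kY); rewrite keptE => -[_ [_ /(_ Y' l kY') N]] /N.
have anti_max Y : (forall x, Y x -> X x) -> big Y ->
    exists Z, anti Z /\ big (fun x => Z x /\ Y x).
  move=> YX bY; have [Z [ZY [bZ dZ]]] := decides_dense n Y bY.
  suff [W [aW B]] : exists W, anti W /\ big (fun x => W x /\ Z x).
    by exists W; split=> //; apply: big_sub B => x [Wx /ZY].
  (* If [Z] were incompatible with every member, the greedy rule would have kept it. *)
  apply: NNPP => N; apply: (N); exists Z; split; last by apply: big_sub bZ.
  right; rewrite keptE; split; first by split=> // x /ZY /YX.
  split=> [r B|Y' _ kY' B]; apply: N.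
  - by exists (d r); split; [left; exists r|exact: comm].
  - by exists Y'; split; [right|exact: comm].
have [h [h_inj h_onto]] := cantor_bernstein
  (fun r => exist anti (d r) (or_introl (ex_intro _ r eq_refl))) (@proj1_sig _ anti)
  (fun r r' e => d_inj r r' (eq_ind _ (fun D => big (fun x => d r x /\ D x))
     (big_sub (fun x h => conj h h) (proj1 (proj2 (proj1 (dP r))))) _ (f_equal (@proj1_sig _ _) e)))
  (@proj1_sig_inj _ _).
exists (fun m => proj1_sig (h m)); split; [|split].
- by move=> m; apply: anti_good; exact: (proj2_sig (h m)).
- move=> m m' B; apply: h_inj; apply: proj1_sig_inj.
  by apply: anti_inj B; exact: proj2_sig.
- move=> Y YX bY; have [Z [aZ B]] := anti_max Y YX bY.
  by have [m e] := h_onto (exist _ Z aZ); exists m; rewrite e.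
Qed.

(** Nodes of level [n] are split into sets deciding the [n]-th value. For density, some [b] inside
    [Y] names [Y] itself at some [n]; a node of level [n + 1] compatible with [b] meets [Y] in a big
    set, so it must be contained in [Y]. *)
Lemma dense_tree : exists E : list (K -> Prop) -> K -> Prop,
  (forall s, big (E s)) /\
  (forall s u x, E (s ++ u) x -> E s x) /\
  (forall s s', big (fun x => E s x /\ E s' x) ->
     exists u, s = s' ++ u \/ s' = s ++ u) /\
  (forall Y, big Y -> exists s, forall x, E s x -> Y x).
Proof.
have [c cP] : exists c : nat * (K -> Prop) -> (K -> Prop) -> K -> Prop,
    forall q, big (snd q) -> splits (fst q) (snd q) (c q).
  apply: (choice (fun q c => big (snd q) -> splits (fst q) (snd q) c)) => -[n X].
  case: (classic (big X)) => [/(deciding_antichain n) [c H]|N]; last by exists (fun _ => X).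
  by exists c.
(* [br] extends a branch at the head of the list, [col_le] at the end; hence the [rev] in the
   witness below. *)
pose fix br (r : list (K -> Prop)) : K -> Prop :=
  match r with nil => fun _ => True | m :: r => c (length r, br r) m end.
have bbr r : big (br r).
  elim: r => [|m r IH]; first exact: big_all.
  by case: (cP (length r, br r) IH) => /(_ m) [_ []].
have brS m r x : br (m :: r) x -> br r x.
  by case: (cP (length r, br r) (bbr r)) => /(_ m) [h _] _; exact: h.
have brA u r x : br (u ++ r) x -> br r x.
  by elim: u => [|m u IH] //= /brS.
have eqlen r r' : length r = length r' -> big (fun x => br r x /\ br r' x) -> r = r'.
  elim: r r' => [|m r IH] [|m' r'] // [] e B.
  have er : r = r' by apply: IH => //; apply: big_sub B => x [/brS + /brS].
  subst r'; case: (cP (length r, br r) (bbr r)) => _ [/(_ m m') h _].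
  by rewrite (h B).
have level n Y : big Y -> exists r, length r = n /\ big (fun x => br r x /\ Y x).
  elim: n Y => [|n IH] Y bY; first by exists nil; split=> //; apply: big_sub bY.
  have [r [e B]] := IH Y bY.
  have [|m Bm] := proj2 (proj2 (cP (length r, br r) (bbr r))) (fun x => br r x /\ Y x) _ B.
    by move=> x [].
  exists (m :: r); split; first by rewrite /= e.
  by apply: big_sub Bm => x [h []].
exists (fun s => br (rev s)); split; first by [].
split; first by move=> s u x; rewrite rev_app_distr => /brA.
split.
- have H s s' : length s' <= length s -> big (fun x => br (rev s) x /\ br (rev s') x) ->
      exists u, s = s' ++ u.
    move=> l B; have es := firstn_skipn (length s') s.
    exists (skipn (length s') s); suff e : rev (firstn (length s') s) = rev s'.
      by rewrite -{1}es -(rev_involutive (firstn _ _)) e rev_involutive.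
    apply: eqlen; first by rewrite !length_rev; exact: firstn_length_le.
    by apply: big_sub B => x [+ h]; rewrite -{1}es rev_app_distr => /brA.
  move=> s s' B; case: (Nat.le_ge_cases (length s') (length s)) => l.
  + by have [u e] := H s s' l B; exists u; left.
  + have [|u e] := H s' s l; last by exists u; right.
    by apply: big_sub B => x [].
- move=> Y bY; have [n /(_ Y) [b [bY' [bb tb]]]] := t_onto Y bY.
  have [[|m r] [//= [e] B]] := level (S n) b bb.
  exists (rev (m :: r)); rewrite rev_involutive.
  case: (cP (length r, br r) (bbr r)) => /(_ m) [_ [_ dec]] _.
  rewrite e in dec; rewrite /= e in B *.
  case: (dec b Y tb B) => // N; case: N.
  by apply: big_sub B => x [h /bY'].
Qed.

End Tree.

(** * Dense embeddings and regular open algebras *)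

Section DenseEmbedding.
Context {T1 T2 : Type} (le1 : T1 -> T1 -> Prop) (le2 : T2 -> T2 -> Prop).
Context (refl1 : forall x, le1 x x) (trans1 : forall x y z, le1 x y -> le1 y z -> le1 x z).
Context (e : T2 -> T1) (e_mono : forall s t, le2 s t -> le1 (e s) (e t)).
Context (e_compat : forall s t, compat le1 (e s) (e t) -> compat le2 s t).
Context (e_dense : forall c, exists s, le1 (e s) c).

Lemma ro_eq {T : Type} {le : T -> T -> Prop} (U V : ro T le) :
  (forall p, proj1_sig U p <-> proj1_sig V p) -> U = V.
Proof.
move=> H; apply: proj1_sig_inj; apply: functional_extensionality => p.
exact: propositional_extensionality.
Qed.

Lemma ro_restrict (U : ro T1 le1) : regular_open le2 (fun s => proj1_sig U (e s)).
Proof.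
case: U => U [down reg] /=; split; first by move=> p q Up /e_mono; exact: down.
move=> s H; apply: reg => q qs; have [t tq] := e_dense q.
have [|r [rt rs]] := e_compat t s.
  by exists (e t); split=> //; exact: trans1 tq qs.
have [r' [r'r Ur']] := H r rs.
exists (e r'); split=> //; apply: trans1 tq; exact: trans1 (e_mono _ _ r'r) (e_mono _ _ rt).
Qed.

Lemma ro_le_restrict (U V : ro T1 le1) :
  (forall s, proj1_sig U (e s) -> proj1_sig V (e s)) -> ro_le U V.
Proof.
case: U V => U [downU regU] [V [downV regV]] /= H p /= Up; apply: regV => q qp.
have [s sq] := e_dense q; exists (e s); split=> //; apply: H.
by apply: downU Up _; exact: trans1 sq qp.
Qed.

Lemma ro_extend (W : ro T2 le2) : regular_open le1
  (fun p => forall q, le1 q p -> exists t, le1 (e t) q /\ proj1_sig W t).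
Proof.
split; first by move=> p q H qp q' q'q; apply: H; exact: trans1 q'q qp.
move=> p H q qp; have [r [rq Hr]] := H q qp.
have [t [tr Wt]] := Hr r (refl1 r).
by exists t; split=> //; exact: trans1 tr rq.
Qed.

Lemma ro_extend_restrict (W : ro T2 le2) s :
  (forall q, le1 q (e s) -> exists t, le1 (e t) q /\ proj1_sig W t) <-> proj1_sig W s.
Proof.
case: W => W [down reg] /=; split.
- move=> H; apply: reg => t ts.
  have [r [rt Wr]] := H (e t) (e_mono _ _ ts).
  have [|u [ur ut]] := e_compat r t; first by exists (e r).
  by exists u; split=> //; exact: down Wr ur.
- move=> Ws q qs; have [t tq] := e_dense q.
  have [|r [rt rs]] := e_compat t s; first by exists (e t); split=> //; exact: trans1 tq qs.
  exists r; split; last exact: down Ws rs.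
  exact: trans1 (e_mono _ _ rt) tq.
Qed.

(** Restriction along [e] is the isomorphism; its inverse sends [W] to the elements below which the
    image of [W] is dense. *)
Lemma ro_iso_dense : ro_iso T1 le1 T2 le2.
Proof.
exists (fun U => exist _ _ (ro_restrict U)).
have le (U V : ro T1 le1) : ro_le U V <-> forall s, proj1_sig U (e s) -> proj1_sig V (e s).
  by split; [move=> H s; exact: H|exact: ro_le_restrict].
split; [|split].
- move=> U V [] E; have H s : proj1_sig U (e s) = proj1_sig V (e s) := f_equal (fun F => F s) E.
  by apply: ro_eq => p; split; apply: (proj2 (le _ _)) => s; rewrite H.
- move=> W; exists (exist _ _ (ro_extend W)); apply: ro_eq => s /=.
  exact: ro_extend_restrict.
- exact: le.
Qed.

End DenseEmbedding.

(** * Compatibility in the separative quotient *)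

Section SeparativeQuotient.
Context {T : Type} (le : T -> T -> Prop).
Context (refl : forall x, le x x) (trans : forall x y z, le x y -> le y z -> le x z).

Lemma sep_le_refl p : sep_le le p p.
Proof. by move=> r rp; exists r. Qed.

Lemma sep_le_trans p q r : sep_le le p q -> sep_le le q r -> sep_le le p r.
Proof.
move=> pq qr u up; have [v [vu vq]] := pq u up; have [w [wv wr]] := qr v vq.
by exists w; split=> //; exact: trans wv vu.
Qed.

Definition to_sq (p : T) : sq T le := exist _ (sep_class le p) (ex_intro _ p eq_refl).

Lemma sep_class_eq p q : sep_class le p = sep_class le q -> sep_le le p q /\ sep_le le q p.
Proof.
move=> E; have : sep_class le p p by split; exact: sep_le_refl.
by rewrite E => -[].
Qed.

Lemma to_sq_onto (c : sq T le) : exists p, c = to_sq p.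
Proof. by case: c => c [p e]; exists p; exact: proj1_sig_inj. Qed.

Lemma sq_le_to_sq p q : sq_le le (to_sq p) (to_sq q) <-> sep_le le p q.
Proof.
split=> [[p' [q' [/sep_class_eq [h1 _] [/sep_class_eq [_ h2] h]]]]|h]; last by exists p, q.
by apply: sep_le_trans h1 _; exact: sep_le_trans h h2.
Qed.

Lemma sq_le_refl c : sq_le le c c.
Proof. by have [p ->] := to_sq_onto c; apply/sq_le_to_sq; exact: sep_le_refl. Qed.

Lemma sq_le_trans c d f : sq_le le c d -> sq_le le d f -> sq_le le c f.
Proof.
have [p ->] := to_sq_onto c; have [q ->] := to_sq_onto d; have [r ->] := to_sq_onto f.
by move=> /sq_le_to_sq a /sq_le_to_sq b; apply/sq_le_to_sq; exact: sep_le_trans a b.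
Qed.

Lemma to_sq_compat p q : compat (sq_le le) (to_sq p) (to_sq q) -> compat le p q.
Proof.
case=> c; have [r ->] := to_sq_onto c => -[/sq_le_to_sq rp /sq_le_to_sq rq].
have [u [ur up]] := rp r (refl r); have [v [vu vq]] := rq u ur.
by exists v; split=> //; exact: trans vu up.
Qed.

End SeparativeQuotient.

(** * The collapse of 2^kappa obtained from the names *)

Theorem mainTheorem15 (K : Type) (lt : K -> K -> Prop) (C : Type)
  (hK : is_cardinal lt)
  (hC : is_cofinality lt C)
  (h1 : card_lt (C -> Prop) K)
  (h2 : card_lt C (C -> Prop))
  (h3 : card_lt nat C)
  (hGCH : powerset_is_successor K) :
  ro_iso (sq (PK lt) (PK_le lt)) (sq_le (PK_le lt))
         (list (K -> Prop)) (col_le (K -> Prop)).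
Proof.
have natC : ~ inj_le C nat by case: h3.
have CK : ~ inj_le K C.
  move=> H; case: h1 => _; apply; apply: inj_le_trans H _; exact: (proj1 h2).
have uncK := uncountable_K natC CK.
have [S] := label_system_exists hK hC natC CK.
have [A [cofA [fewA [CA AC]]]] := thin_cofinal_set hK hC natC CK.
have [ltM [woM cardM]] := initial_order (K -> Prop).
(* By 2^kappa = kappa^+ a segment embeds in [K] or has full size 2^kappa; an initial order excludes
   the latter. *)
have segM m : inj_le (seg ltM m) K.
  by case: (proj2 hGCH (fun m' => ltM m' m)) => // /cardM.
have [g gi] : inj_le ((K -> Prop) * (K -> Prop)) (K -> Prop).
  apply: inj_le_square; apply: inj_le_trans (inj_le_of_not uncK) _.
  by case: hGCH => -[].
pose en m := epsilon (inhabits (fun _ : K => False, fun _ : K => False)) (fun q => g q = m).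
have en_onto q : exists m, en m = q.
  exists (g q); apply: gi; exact: (epsilon_spec _ (fun q' => g q' = g q)) (ex_intro _ q eq_refl).
have [t [t_fun t_onto]] := collapsing_names_of_labels hK hC natC CK S A cofA fewA CA AC
  woM segM en en_onto.
have [E [bE [subE [compE denseE]]]] := dense_tree t t_fun t_onto.
pose EP s : PK lt := exist _ (E s) (order_iso_of_big hK (E s) (bE s)).
have reflP (X : PK lt) : PK_le lt X X by [].
have transP (X Y Z : PK lt) : PK_le lt X Y -> PK_le lt Y Z -> PK_le lt X Z.
  by move=> XY YZ x /XY /YZ.
(* The dense embedding sends [s] to the class of [E s]; the goals are monotonicity, reflection of
   compatibility and density. *)
apply: (ro_iso_dense _ _ (sq_le_refl _ reflP transP) (sq_le_trans _ reflP transP)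
  (fun s => to_sq (PK_le lt) (EP s))).
- move=> s s' [u ->]; apply/(sq_le_to_sq _ reflP transP) => r rs; exists r; split=> // x /rs /=.
  exact: subE.
- move=> s s' /(to_sq_compat _ reflP transP) [r [rs rs']].
  have [|u [e|e]] := compE s s'.
  + apply: big_sub (big_of_order_iso hK _ (proj2_sig r)) => x rx.
    by split; [exact: rs|exact: rs'].
  + by exists s; split; [exists nil; rewrite app_nil_r|exists u].
  + by exists s'; split; [exists u|exists nil; rewrite app_nil_r].
- move=> c; have [p ->] := to_sq_onto _ c.
  have [s h] := denseE _ (big_of_order_iso hK _ (proj2_sig p)).
  exists s; apply/(sq_le_to_sq _ reflP transP) => r rs; exists r; split=> // x /rs; exact: h.
Qed.
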